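(* Consider the gossip algorithm described in the context, under the standing assumptions stated there (including strict monotonicity of $F$ and the Lipschitz conditions). Let $x^*$ be the Nash equilibrium of the game. Then the sequence of action profiles $\{x(k)\}$ generated by the algorithm converges to $x^*$ almost surely.
   Context: Graphs and matrices. Let $V=\{1,\ldots,N\}$, $N\ge2$, and let $G_I=(V,E_I)$ (interference graph) be a connected undirected graph which is not complete, with adjacency matrix $A$; $B=A+I_N$. For $i\in V$: $N_I(i)$ is the neighbor set of $i$ in $G_I$, $\tilde N_I(i)=N_I(i)\cup\{i\}$, $m_i=\deg_{G_I}(i)+1$; $m=\sum_i m_i$. For $i,j\in V$: $s_{ij}=\sum_{l=1}^{j}B(i,l)+\sum_{r=1}^{i-1}m_r$; $E_j^i=e_{s_{ij}}\in\mathbb{R}^m$ if $j\in\tilde N_I(i)$, $E_j^i=\mathbf 0_m$ otherwise. The communication graph $G_C=(V,E_C)$ satisfies $G_m\subseteq G_C\subseteq G_I$ for a maximal triangle-free spanning subgraph $G_m$ of $G_I$ (triangle-free, spanning, and adding any edge of $G_I$ not in $G_m$ creates a triangle); $N_C(i)$ is the neighbor set of $i$ in $G_C$. $\mathrm{ind}(i,j)=\tilde N_I(i)\cap\tilde N_I(j)$ and $W_{ij}=I_m-\tfrac12\sum_{l\in\mathrm{ind}(i,j)}(E_l^i-E_l^j)(E_l^i-E_l^j)^T$. Game. Player $i$ has action set $\Omega_i\subset\mathbb{R}$, nonempty, compact and convex; $\Omega=\prod_i\Omega_i$. Player $i$'s cost is $J_i:\Omega^i\to\mathbb{R}$, $\Omega^i=\prod_{j\in\tilde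 N_I(i)}\Omega_j$, written $J_i(x_i,x_{-i}^i)$ with $x_{-i}^i\in\Omega_{-i}^i=\prod_{j\in N_I(i)}\Omega_j$; $J_i$ is continuously differentiable in $x_i$, jointly continuous in $x^i$, and convex in $x_i$ for every $x_{-i}^i$. The pseudo-gradient $F:\Omega\to\mathbb{R}^N$, $F(x)=(\nabla_{x_i}J_i(x^i))_{i\in V}$, is strictly monotone: $(F(x)-F(y))^T(x-y)>0$ for all $x\ne y$ in $\Omega$. For each $i$, $\nabla_{x_i}J_i(x_i,u)$ is Lipschitz in $x_i\in\Omega_i$ (constant $\sigma_i>0$) for each fixed $u\in\Omega_{-i}^i$, and Lipschitz in $u$ (constant $L_i>0$) for each fixed $x_i\in\Omega_i$. A Nash equilibrium is $x^*\in\Omega$ with $J_i(x_i^*,x_{-i}^{i*})\le J_i(x_i,x_{-i}^{i*})$ for all $x_i\in\Omega_i$ and all $i\in V$; under these assumptions it is unique. $T_{\Omega_i}$ denotes Euclidean projection onto $\Omega_i$. Algorithm. The state is $\tilde x(k)\in\mathbb{R}^m$, whose entry at position $s_{ij}$ ($i\in V$, $j\in\tilde N_I(i)$) is $\tilde x_j^i(k)\in\Omega_j$; the actions are $x_i(k)=\tilde x_i^i(k)$ and $x(k)=(x_1(k),\dots,x_N(k))$. Initial values $\tilde x^i(0)\in\Omega^i$ are arbitrary. At iteration $k$: $i_k$ is drawn uniformly from $V$ and $j_k$ uniformly from $N_C(i_k)$, independently of the past; $W(k)=W_{i_kj_k}$; $\bar x(k)=W(k)\tilde x(k)$; $\hat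 x_{-i}^i(k)=(\bar x_{s_{ij}}(k))_{j\in N_I(i)}$; for $i\in\{i_k,j_k\}$, $x_i(k+1)=T_{\Omega_i}[x_i(k)-\alpha_{k,i}\nabla_{x_i}J_i(x_i(k),\hat x_{-i}^i(k))]$, and $x_i(k+1)=x_i(k)$ otherwise; then $\tilde x_j^i(k+1)=\bar x_{s_{ij}}(k)$ for $j\in N_I(i)$ and $\tilde x_i^i(k+1)=x_i(k+1)$. The step sizes are $\alpha_{k,i}=1/\nu_k(i)$, where $\nu_k(i)$ is the number of updates player $i$ has made up to time $k$; they satisfy $\sum_k\alpha_{k,i}^2<\infty$ and $\sum_k\alpha_{k,i}=\infty$ for all $i$. *)

(* Defs.v *)
From HB Require Import structures.
From mathcomp Require Import all_boot all_order all_algebra.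
From mathcomp Require Import all_classical all_reals all_analysis.
Set Implicit Arguments. Unset Strict Implicit. Unset Printing Implicit Defensive.
Import Order.TTheory GRing.Theory Num.Theory.
Import numFieldNormedType.Exports.
Local Open Scope classical_set_scope.
Local Open Scope ring_scope.

Section Graphs.
Variable N : nat.
Implicit Types (e : rel 'I_N).

Definition simple_graph e := symmetric e /\ irreflexive e.
Definition connected_graph e := forall i j : 'I_N, connect e i j.
Definition complete_graph e := forall i j : 'I_N, i != j -> e i j.
Definition triangle_free e := ~ exists a b c : 'I_N, [&& e a b, e b c & e c a].
Definition add_edge e (a b : 'I_N) : rel 'I_N :=
  fun x y => [|| e x y, (x == a) && (y == b) | (x == b) && (y == a)].
Definition maximal_triangle_free_spanning (em e : rel 'I_N) :=
  [/\ simple_graph em, subrel em e, triangle_free em &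
      forall a b, e a b -> ~~ em a b -> ~ triangle_free (add_edge em a b)].

Definition Ntil e (i : 'I_N) : pred 'I_N := fun j => (j == i) || e i j.
Definition mdeg e (i : 'I_N) : nat := #|[pred j | e i j]|.+1.
Definition mdim e : nat := \sum_(i < N) mdeg e i.
Definition Bmat e (i l : 'I_N) : nat := (e i l : nat) + (i == l : nat).
(* s_ij (1-based position in R^m) *)
Definition spos e (i j : 'I_N) : nat :=
  (\sum_(l < N | (l <= j)%N) Bmat e i l + \sum_(r < N | (r < i)%N) mdeg e r)%N.
Definition ind e (i j : 'I_N) : pred 'I_N := fun l => Ntil e i l && Ntil e j l.
End Graphs.

Section Algorithm.
Variables (R : realType) (N : nat) (e : rel 'I_N).
Local Notation m := (mdim e).

Definition Evec (i j : 'I_N) : 'cV[R]_m :=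
  \col_(p < m) (if Ntil e i j && (p.+1 == spos e i j) then 1 else 0).

Definition Wmat (i j : 'I_N) : 'M[R]_m :=
  1%:M - 2^-1 *: \sum_(l < N | ind e i j l)
                   ((Evec i l - Evec j l) *m (Evec i l - Evec j l)^T).

Definition entry (v : 'cV[R]_m) (i j : 'I_N) : R := ((Evec i j)^T *m v) 0 0.

Definition proj (S : set R) (y : R) : R :=
  xget 0 [set p | S p /\ forall q, S q -> `|y - p| <= `|y - q|].

Variables (Omega : 'I_N -> set R) (g : 'I_N -> R -> ('I_N -> R) -> R).

Definition nupdates (sel : nat -> 'I_N * 'I_N) (k : nat) (i : 'I_N) : nat :=
  \sum_(t < k.+1) ((i == (sel t).1) || (i == (sel t).2) : nat).

(* one iteration of the gossip algorithm at time k, with (i_k, j_k) = sel k;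
   g i x u stands for nabla_{x_i} J_i(x, u) *)
Definition step (sel : nat -> 'I_N * 'I_N) (k : nat) (xt : 'cV[R]_m) : 'cV[R]_m :=
  let a := (sel k).1 in let b := (sel k).2 in
  let xbar := Wmat a b *m xt in
  let xhat := fun i j => entry xbar i j in
  let xnew := fun i =>
    if (i == a) || (i == b) then
      proj (Omega i) (entry xt i i
                      - (nupdates sel k i)%:R^-1 * g i (entry xt i i) (xhat i))
    else entry xt i i in
  xbar + \sum_(i < N) (xnew i - entry xbar i i) *: Evec i i.

Fixpoint state (sel : nat -> 'I_N * 'I_N) (x0 : 'cV[R]_m) (k : nat) : 'cV[R]_m :=
  match k with
  | 0 => x0
  | k'.+1 => step sel k' (state sel x0 k')
  end.

Definition actions (sel : nat -> 'I_N * 'I_N) (x0 : 'cV[R]_m) (k : nat) : 'rV[R]_N :=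
  \row_i entry (state sel x0 k) i i.
End Algorithm.

Section Game.
Variables (R : realType) (N : nat) (e : rel 'I_N) (Omega : 'I_N -> set R).

Definition convex_set_R (S : set R) :=
  forall x y t, S x -> S y -> 0 <= t <= 1 -> S (t * x + (1 - t) * y).

Definition in_Omega_minus (i : 'I_N) (u : 'I_N -> R) :=
  forall j, e i j -> Omega j (u j).

Definition in_Omega (x : 'I_N -> R) := forall i, Omega i (x i).

Variables (J g : 'I_N -> R -> ('I_N -> R) -> R) (sigma L : 'I_N -> R).

(* J i x u = J_i(x, u_{N_I(i)}) : depends on u only through N_I(i);
   g i x u = nabla_{x_i} J_i(x, u_{N_I(i)}) *)
Definition game_assumptions :=
  [/\ (forall i, Omega i !=set0 /\ compact (Omega i) /\ convex_set_R (Omega i)),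
      (forall i x u v, (forall j, e i j -> u j = v j) -> J i x u = J i x v),
      (forall i x u v, (forall j, e i j -> u j = v j) -> g i x u = g i x v),
      (forall i u x, in_Omega_minus i u -> Omega i x ->
         (fun y => (J i y u - J i x u) / (y - x)) @ within (Omega i) (x^')
           --> g i x u) &
   [/\ (forall i u, in_Omega_minus i u -> {within Omega i, continuous (fun y => g i y u)}),
      (forall i, {within [set p : R * 'rV[R]_N | Omega i p.1 /\ in_Omega_minus i (fun j => p.2 0 j)],
                  continuous (fun p => J i p.1 (fun j => p.2 0 j))}),
      (forall i u x y t, in_Omega_minus i u -> Omega i x -> Omega i y -> 0 <= t <= 1 ->
         J i (t * x + (1 - t) * y) u <= t * J i x u + (1 - t) * J i y u),
      (forall x y, in_Omega x -> in_Omega y -> x <> y ->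
         0 < \sum_(i < N) (g i (x i) x - g i (y i) y) * (x i - y i)) &
   [/\
      (forall i, 0 < sigma i /\ forall u x y, in_Omega_minus i u -> Omega i x -> Omega i y ->
         `|g i x u - g i y u| <= sigma i * `|x - y|) &
      (forall i, 0 < L i /\ forall x u v, Omega i x -> in_Omega_minus i u -> in_Omega_minus i v ->
         `|g i x u - g i x v| <= L i * Num.sqrt (\sum_(j < N | e i j) (u j - v j) ^+ 2))]]].

Definition nash_equilibrium (xs : 'I_N -> R) :=
  in_Omega xs /\ forall i y, Omega i y -> J i (xs i) xs <= J i y xs.
End Game.

Section Selection.
Variables (R : realType) (N : nat) (eC : rel 'I_N).

Definition pair_prob (a b : 'I_N) : R :=
  if eC a b then (N%:R)^-1 * (#|[pred j | eC a j]|%:R)^-1 else 0.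

Variables (d : measure_display) (T : measurableType d) (P : probability T R)
  (I Js : nat -> T -> 'I_N).

(* the pairs (i_k, j_k) are i.i.d. with law pair_prob: the law of every finite
   prefix is the product law *)
Definition iid_selection :=
  (forall k a, measurable (I k @^-1` [set a]) /\ measurable (Js k @^-1` [set a])) /\
  forall (n : nat) (a b : nat -> 'I_N),
    P [set w | forall k, (k < n)%N -> I k w = a k /\ Js k w = b k] =
      (\prod_(k < n) pair_prob (a k) (b k))%:E.
End Selection.

(* Main.v *)
Require Import Defs.
From HB Require Import structures.
From mathcomp Require Import all_boot all_order all_algebra.
From mathcomp Require Import all_classical all_reals all_analysis.
From mathcomp Require Import measurable_realfun ring lra zify.
Import Order.TTheory GRing.Theory Num.Theory.
Import numFieldNormedType.Exports.
Local Open Scope classical_set_scope.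
Local Open Scope ring_scope.

(* The argument is pathwise: only two strong laws of large numbers are random.
   Almost surely every player i is updated with a positive frequency p_i, and a
   fixed finite word of gossip pairs recurs with positive frequency; both follow
   from a second-moment law for pairwise independent events.

   Consensus: a player's own entry is not averaged, so it acts as a leader that
   moves by O(1/k) per step.  By maximal triangle-freeness every neighbour of j is
   within two gossip hops of j inside the closed neighbourhood of j, so one
   occurrence of the word contracts all disagreements by a fixed factor.  The
   gaps between occurrences are o(k), hence the drift in between is negligible.

   Convergence: the player-dependent step 1/nu_k(i) is the increment of the
   harmonic sum, i.e. of ln nu_k(i), up to O(1/k^2), and
   theta_k(i) = ln (nu_k(i) / k) - ln p_i tends to 0.  Correcting the squared
   distance to x* by 2 sum_i theta_k(i) F_i(x(k)) (x_i(k) - x*_i) therefore turns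
   all random steps into the common step 1/(k+1), and the corrected energy
   decreases by (2 F(x)^T (x - x* ) - o(1)) / (k+1).  Strict monotonicity,
   compactness and the divergence of the harmonic series conclude. *)

(** * A strong law of large numbers for pairwise independent events *)

Lemma sum_inv_sqr_le2 (R : realType) (n : nat) :
  \sum_(k < n) ((k.+1)%:R ^+ 2)^-1 <= 2 :> R.
Proof.
(* The bound 2 is not inductive; 2 - 1/(m+1) is, because 1/(x+1)^2 <= 1/x - 1/(x+1). *)
suff H m : \sum_(k < m.+1) ((k.+1)%:R ^+ 2)^-1 <= 2 - (m.+1)%:R^-1 :> R.
  case: n => [|m]; first by rewrite big_ord0.
  by apply: (le_trans (H m)); rewrite gerBl invr_ge0.
elim: m => [|m IH]; first by rewrite big_ord_recr big_ord0 /= add0r expr1n; lra.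
rewrite big_ord_recr /=; apply: (le_trans (lerD IH (lexx _))).
rewrite -(natr1 m.+1).
have : 0 < (m.+1)%:R :> R by [].
move: (m.+1)%:R => x x0.
rewrite -subr_ge0.
have -> : 2 - (x + 1)^-1 - (2 - x^-1 + ((x + 1) ^+ 2)^-1) =
   (x * (x + 1) ^+ 2)^-1.
  by field; apply/andP; split; lra.
by rewrite invr_ge0 mulr_ge0 ?ltW// exprn_gt0//; lra.
Qed.

Lemma cvg_seqP (R : realType) (u : nat -> R) (l : R) :
  u @ \oo --> l <->
  forall e : R, 0 < e -> exists N, forall n, (N <= n)%N -> `|u n - l| <= e.
Proof.
split.
  move=> /cvgrPdist_le H e e0; have [N _ HN] := H _ e0.
  by exists N => n Nn; rewrite distrC; exact: HN.
move=> H; apply/cvgrPdist_le => e e0; have [N HN] := H _ e0.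
by exists N => // n /= Nn; rewrite distrC; exact: HN.
Qed.

Lemma square_bracket (m : nat) : (0 < m)%N ->
  exists n, (n.+1 ^ 2 <= m < n.+2 ^ 2)%N.
Proof.
case: m => // m _; elim: m => [|m [n /andP[nm mn]]]; first by exists 0%N.
have [lt|] := ltnP m.+2 (n.+2 ^ 2).
  by exists n; rewrite lt (leq_trans nm).
by move=> le; exists n.+1; rewrite le /=; nia.
Qed.

(** Interpolation between squares: only O(n) indices lie between (n+1)^2 and (n+2)^2 and [S] grows
    by at most 1 per index, so the average hardly changes in between. The hypothesis is phrased with
    squared deviations because that is what a second-moment bound yields. *)
Lemma avg_cvg_of_squares (R : realType) (S : nat -> R) (p : R) :
  (forall n, 0 <= S n.+1 - S n <= 1) ->
  (fun n => (S (n.+1 ^ 2)%N / (n.+1 ^ 2)%:R - p) ^+ 2) @ \oo --> 0 ->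
  (fun n => S n / n%:R) @ \oo --> p.
Proof.
move=> S1 /cvg_seqP sq; apply/cvg_seqP => e e0.
have Slip q r : 0 <= S (q + r)%N - S q <= r%:R.
  elim: r => [|r IH]; first by rewrite addn0 subrr lexx.
  by rewrite addnS -natr1; move: (S1 (q + r)%N); lra.
have e2 : 0 < (e / 2) ^+ 2 by rewrite exprn_gt0// divr_gt0.
have [M HM] := sq _ e2.
(* With x = n+1, the passage from x^2 to m costs at most 2 x (1 + |p|) before division by m. Taking
   1/x below this threshold makes that cost at most e m / 2; the deviation at the square itself
   takes the other half. *)
have b0 : 0 < e / (4 * (1 + `|p|)).
  by rewrite divr_gt0// mulr_gt0// ltr_pwDl.
have [M' HM'] := (cvg_seqP _ _ _).1 (@cvg_harmonic R) _ b0.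
exists ((maxn M M').+2 ^ 2)%N => m mM.
have m0 : (0 < m)%N by apply: leq_trans mM.
have [n /andP[nm mn]] := square_bracket m m0.
have nM : (maxn M M' <= n)%N.
  by have := leq_ltn_trans mM mn; rewrite ltn_sqr !ltnS => /ltnW.
move: nM; rewrite geq_max => /andP[/HM + /HM'].
rewrite subr0 ger0_norm ?sqr_ge0// subr0 ger0_norm ?harmonic_ge0// /harmonic /=.
rewrite -[X in X <= _]real_normK ?num_real// ler_sqr ?nnegrE ?divr_ge0 ?(ltW e0)//.
move: (Slip (n.+1 ^ 2)%N (m - n.+1 ^ 2)%N); rewrite subnKC// => Sm.
have : (m - n.+1 ^ 2 <= 2 * n.+1)%N by nia.
rewrite -(ler_nat R) natrB// natrM.
have : (n.+1 ^ 2)%:R <= m%:R :> R by rewrite ler_nat.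
rewrite natrB// in Sm.
have : 0 < (n.+1 ^ 2)%:R :> R by rewrite ltr0n.
have : 0 < n.+1%:R :> R by [].
have : (n.+1 ^ 2)%:R = n.+1%:R ^+ 2 :> R by rewrite natrX.
move: (n.+1 ^ 2)%:R (S (n.+1 ^ 2)%N) (n.+1)%:R m%:R (S m) Sm => q Sq x y T Sm.
move=> qE x0 q0 qy yq.
move=> Hq; rewrite ler_pdivlMr; last by rewrite mulr_gt0// ltr_pwDl.
rewrite [_^-1 * _]mulrC ler_pdivrMr// => xe; move: Hq.
have -> : Sq / q - p = (Sq - q * p) / q by field; rewrite gt_eqF.
have y0 : 0 < y by exact: lt_le_trans qy.
have -> : T / y - p = (T - y * p) / y by field; rewrite gt_eqF.
rewrite !normrM !normfV (gtr0_norm q0) (gtr0_norm y0) !ler_pdivrMr// => Hq.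
have -> : T - y * p = (T - Sq) + (Sq - q * p) + (q - y) * p by ring.
have h1 : `|T - Sq| <= 2 * x by rewrite ger0_norm; lra.
have h2 : `|(q - y) * p| <= 2 * x * `|p|.
  by rewrite normrM ler_wpM2r// ler0_norm; lra.
apply: (le_trans (ler_normD _ _)); apply: (le_trans (lerD (ler_normD _ _) (lexx _))).
have h3 : e / 2 * q <= e / 2 * y by rewrite ler_pM2l// divr_gt0.
have h4 : 4 * (1 + `|p|) * x <= e * y.
  apply: (le_trans _ (_ : e * q <= _)); last by rewrite ler_pM2l.
  by rewrite qE expr2 mulrA ler_pM2r.
lra.
Qed.

Section SLLN.
Context {R : realType} {d : measure_display} {T : measurableType d}.
Variables (P : probability T R) (A : nat -> set T) (p : R).
Hypothesis mA : forall t, measurable (A t).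
Hypothesis PA : forall t, P (A t) = p%:E.
Hypothesis PAA : forall s t, s != t -> P (A s `&` A t) = (p * p)%:E.

Let S (n : nat) (w : T) : R := \sum_(t < n) \1_(A t) w.

Let mS n : measurable_fun setT (S n).
Proof. by apply: measurable_sum => t; exact/measurable_indicP. Qed.

Let p_ge0 : 0 <= p.
Proof. by rewrite -lee_fin -(PA 0); exact: measure_ge0. Qed.

Let S_ge0 n w : 0 <= S n w.
Proof. by apply: sumr_ge0 => t _; rewrite indicE. Qed.

Let EA t : (\int[P]_w (\1_(A t) w)%:E = p%:E)%E.
Proof. by rewrite integral_indic// setIT; exact: PA. Qed.

Let EAA s t : s != t -> (\int[P]_w (\1_(A s `&` A t) w)%:E = (p * p)%:E)%E.
Proof.
by move=> st; rewrite integral_indic ?setIT//; [exact: PAA|exact: measurableI].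
Qed.

Let ES n : (\int[P]_w (S n w)%:E = (n%:R * p)%:E)%E.
Proof.
under eq_integral do rewrite -sumEFin.
rewrite ge0_integral_sum//; last first.
  by move=> t; apply/measurable_EFinP; exact/measurable_indicP.
under eq_bigr do rewrite EA.
by rewrite sumEFin sumr_const card_ord mulr_natl.
Qed.

(** Expanding the square gives n diagonal terms of mean p and n (n - 1) off-diagonal terms of mean
    p^2; pairwise independence enters here. *)
Let ES2 n :
  (\int[P]_w ((S n w) ^+ 2)%:E = (n%:R * p + n%:R * (n%:R - 1) * p ^+ 2)%:E)%E.
Proof.
have -> : (fun w => ((S n w) ^+ 2)%:E) =
    (fun w => \sum_(s < n) \sum_(t < n) (\1_(A s `&` A t) w)%:E)%E.
  apply/funext => w; under eq_bigr do rewrite sumEFin.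
  rewrite sumEFin expr2 /S big_distrl /=; congr EFin.
  apply: eq_bigr => s _; rewrite big_distrr /=.
  by apply: eq_bigr => t _; rewrite indicI.
rewrite ge0_integral_sum//; last 2 first.
- move=> s; apply: emeasurable_sum => t; apply/measurable_EFinP.
  exact/measurable_indicP/measurableI.
- by move=> s w _; apply: sume_ge0 => t _; rewrite lee_fin indicE.
have E1 (s : 'I_n) : (\int[P]_w \sum_(t < n) (\1_(A s `&` A t) w)%:E
    = (p + (n%:R - 1) * p ^+ 2)%:E)%E.
  rewrite ge0_integral_sum//; last first.
    by move=> t; apply/measurable_EFinP; exact/measurable_indicP/measurableI.
  rewrite (bigD1 s)//= setIid EA.
  rewrite (eq_bigr (fun=> (p ^+ 2)%:E)); last first.
    by move=> t ts; rewrite EAA// eq_sym.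
  rewrite sumEFin -EFinD; congr (_ + _)%:E.
  rewrite sumr_const (@eq_card _ _ (predC1 s))// cardC1 card_ord.
  by case: n s => [[]//|k s /=]; rewrite -natr1 addrK mulr_natl.
under eq_bigr do rewrite E1.
rewrite sumEFin sumr_const card_ord -[X in X%:E]mulr_natl; congr EFin; ring.
Qed.

Let EV n : (\int[P]_w ((S n w - n%:R * p) ^+ 2)%:E <= n%:R%:E)%E.
Proof.
set J := (X in (X <= _)%E).
have mQ : measurable_fun setT (fun w => (S n w - n%:R * p) ^+ 2).
  by apply: measurable_funX; apply: measurable_funB => //; exact: measurable_cst.
(* All terms are kept nonnegative, so no integrability is needed. *)
have : (J + (2 * (n%:R * p) * (n%:R * p))%:E =
    (n%:R * p + n%:R * (n%:R - 1) * p ^+ 2)%:E + ((n%:R * p) ^+ 2)%:E)%E.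
  have -> : (2 * (n%:R * p) * (n%:R * p))%:E =
      (\int[P]_w ((2 * (n%:R * p) * S n w)%:E))%E.
    under eq_integral do rewrite EFinM.
    rewrite ge0_integralZl//.
    - by rewrite ES.
    - exact/measurable_EFinP.
    - by move=> w _; rewrite lee_fin.
    - by rewrite lee_fin !mulr_ge0.
  have -> : ((n%:R * p) ^+ 2)%:E = (\int[P]_w (((n%:R * p) ^+ 2)%:E))%E.
    by rewrite integral_cst//= probability_setT mule1.
  rewrite -ES2 -!ge0_integralD//.
  - apply: eq_integral => w _; rewrite -!EFinD; congr EFin; ring.
  - by move=> w _; rewrite lee_fin sqr_ge0.
  - by apply/measurable_EFinP; apply: measurable_funX.
  - by move=> w _; rewrite lee_fin sqr_ge0.
  - by move=> w _; rewrite lee_fin sqr_ge0.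
  - exact/measurable_EFinP.
  - by move=> w _; rewrite lee_fin !mulr_ge0.
  - by apply/measurable_EFinP; apply: measurable_funM => //; exact: measurable_cst.
rewrite -EFinD; move: J => [r||]//; rewrite -EFinD => -[H].
have p1 : p <= 1 by rewrite -lee_fin -(PA 0) probability_le1.
rewrite lee_fin.
have -> : r = n%:R * p - n%:R * p ^+ 2.
  apply: (addIr (2 * (n%:R * p) * (n%:R * p))); rewrite H; ring.
have n0 : 0 <= n%:R :> R by [].
have : 0 <= n%:R * (1 - p) by rewrite mulr_ge0// subr_ge0.
have : 0 <= n%:R * p ^+ 2 by rewrite mulr_ge0// sqr_ge0.
lra.
Qed.

Let sq_avg (n : nat) (w : T) : R :=
  (S (n.+1 ^ 2) w / ((n.+1) ^ 2)%:R - p) ^+ 2.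

(** By [EV] the mean of [sq_avg n] is at most 1/(n+1)^2, which is summable. The series of the
    [sq_avg n] thus has finite integral, so it is finite almost everywhere and its terms tend to
    0. *)
Let sq_avg_cvg : {ae P, forall w, sq_avg ^~ w @ \oo --> 0}.
Proof.
have msq n : measurable_fun setT (fun w => (sq_avg n w)%:E).
  apply/measurable_EFinP; apply: measurable_funX; apply: measurable_funB => //.
  by apply: measurable_funM.
have sq0 n w : (0 <= (sq_avg n w)%:E)%E by rewrite lee_fin sqr_ge0.
have I1 n : (\int[P]_w (sq_avg n w)%:E <= (((n.+1)%:R ^+ 2)^-1)%:E)%E.
  have nz : ((n.+1 ^ 2)%:R : R) != 0 by rewrite pnatr_eq0.
  have -> : (fun w => (sq_avg n w)%:E) = (fun w => (((n.+1 ^ 2)%:R ^+ 2)^-1)%:E *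
     ((S (n.+1 ^ 2) w - (n.+1 ^ 2)%:R * p) ^+ 2)%:E)%E.
    by apply/funext => w; rewrite -EFinM /sq_avg; congr EFin; field.
  rewrite ge0_integralZl//; last 2 first.
  - apply/measurable_EFinP; apply: measurable_funX; apply: measurable_funB => //.
  - by move=> w _; rewrite lee_fin sqr_ge0.
  apply: (le_trans (lee_wpmul2l _ (EV _))).
    by rewrite lee_fin invr_ge0 sqr_ge0.
  by rewrite -EFinM lee_fin -[(n.+1)%:R ^+ 2]natrX;
    move: (_ ^ 2)%:R nz => x nz; rewrite expr2 invfM mulfVK.
have fin : (\int[P]_w (\sum_(n <oo) (sq_avg n w)%:E) < +oo)%E.
  rewrite integral_nneseries//.
  apply: (@le_lt_trans _ _ 2%:E); last by rewrite ltry.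
  apply: lime_le; first by apply: is_cvg_nneseries => n _ _; exact: integral_ge0.
  apply: nearW => n; rewrite big_mkord.
  apply: (@le_trans _ _ (\sum_(k < n) (((k.+1)%:R ^+ 2)^-1)%:E)%E).
    by apply: lee_sum => k _; exact: I1.
  by rewrite sumEFin lee_fin sum_inv_sqr_le2.
have mser : measurable_fun setT (fun w => \sum_(n <oo) (sq_avg n w)%:E)%E.
  by apply: ge0_emeasurable_sum.
have int : P.-integrable setT (fun w => \sum_(n <oo) (sq_avg n w)%:E)%E.
  apply/integrableP; split => //.
  under eq_integral => w _ do rewrite gee0_abs ?nneseries_ge0//.
  exact: fin.
apply: filterS (integrable_ae measurableT int) => w /(_ Logic.I) wfin.
apply: (@cvg_series_cvg_0 _ R^o).
apply: nondecreasing_is_cvgn.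
  by apply: nondecreasing_series => n _ _; rewrite -lee_fin.
exists (fine (\sum_(n <oo) (sq_avg n w)%:E)%E) => _ [n _ <-].
rewrite -lee_fin fineK// /series /= -sumEFin.
exact: nneseries_lim_ge.
Qed.

Lemma pairwise_indep_slln :
  {ae P, forall w, (fun n => (\sum_(t < n) \1_(A t) w) / n%:R) @ \oo --> p}.
Proof.
apply: filterS sq_avg_cvg => w; apply: avg_cvg_of_squares => n.
by rewrite big_ord_recr /= addrAC subrr add0r indicE;
  case: (_ \in _); rewrite lexx ler01.
Qed.
End SLLN.

(** * Recurrence of finite words in the i.i.d. selection *)

Section FiniteUnion.
Context {R : realType} {d : measure_display} {T : measurableType d}.
Lemma measure_bigcup_finType (mu : {measure set T -> \bar R}) (F : finType)
    (D : pred F) (E : F -> set T) :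
  (forall f, measurable (E f)) -> trivIset setT E ->
  mu (\bigcup_(f in [set f | D f]) E f) = (\sum_(f | D f) mu (E f))%E.
Proof.
move=> mE tE; rewrite -big_filter.
have -> : [set f | D f] = [set` [seq f <- index_enum F | D f]].
  by apply/seteqP; split => f /=; rewrite mem_filter mem_index_enum andbT.
have : uniq [seq f <- index_enum F | D f] by rewrite filter_uniq// index_enum_uniq.
elim: [seq f <- index_enum F | D f] => [|f s IH /= /andP[fs us]].
  by rewrite big_nil classical_sets.bigcup_seq big_nil measure0.
rewrite [RHS]big_cons classical_sets.bigcup_seq big_cons measureU//.
- by congr (_ + _)%E; rewrite -classical_sets.bigcup_seq; exact: IH.
- by apply: bigsetU_measurable.
- rewrite -classical_sets.bigcup_seq -subset0 => w [Ef [g /= gs Eg]].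
  have fg : f = g by apply: (tE f g) => //; exists w.
  by rewrite fg gs in fs.
Qed.
End FiniteUnion.

Section IID.
Context {R : realType} {N : nat} (eC : rel 'I_N) {d : measure_display}
  {T : measurableType d} (P : probability T R) (I Js : nat -> T -> 'I_N).
Hypothesis iid : iid_selection eC P I Js.

Definition mass (Q : pred ('I_N * 'I_N)) : R :=
  \sum_(z | Q z) pair_prob R eC z.1 z.2.

Let measurable_prefix n (a b : nat -> 'I_N) :
  measurable [set w | forall k, (k < n)%N -> I k w = a k /\ Js k w = b k].
Proof.
rewrite (_ : [set w | _] = \bigcap_(k in `I_n)
    (I k @^-1` [set a k] `&` Js k @^-1` [set b k])); last first.
  by apply/seteqP; split => w Hw k; exact: Hw.
apply: fin_bigcap_measurable; first exact: finite_II.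
by move=> k _; apply: measurableI; [exact: (iid.1 k (a k)).1|exact: (iid.1 k (b k)).2].
Qed.

(** The event splits into the disjoint prefix events of the words f with [Q k (f k)] for all k < n.
    Each has a product law, and distributivity turns the sum of products into a product of sums. *)
Lemma iid_prefix_law (i0 : 'I_N) (Q : nat -> pred ('I_N * 'I_N)) n :
  measurable [set w | forall k, (k < n)%N -> Q k (I k w, Js k w)] /\
  P [set w | forall k, (k < n)%N -> Q k (I k w, Js k w)] =
    (\prod_(k < n) mass (Q k))%:E.
Proof.
(* [iid_selection] takes words indexed by all of nat; the filler (i0, i0) past n is never read,
   since prefix events look at k < n only. *)
pose ext (f : {ffun 'I_n -> 'I_N * 'I_N}) k := oapp f (i0, i0) (insub k).
have extE f (k : 'I_n) : ext f k = f k.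
  by rewrite /ext valK.
pose E f := [set w | forall k, (k < n)%N ->
  I k w = (ext f k).1 /\ Js k w = (ext f k).2].
have mE f : measurable (E f) by exact: measurable_prefix.
have -> : [set w | forall k, (k < n)%N -> Q k (I k w, Js k w)] =
    \bigcup_(f in [set f | f \in family (fun k : 'I_n => Q k)]) E f.
  apply/seteqP; split => [w Qw|w [f /= /familyP fQ Ef] k kn]; last first.
    have [-> ->] := Ef k kn; rewrite -surjective_pairing.
    by have := fQ (Ordinal kn); rewrite -extE.
  exists [ffun k : 'I_n => (I k w, Js k w)].
    by apply/familyP => k; rewrite ffunE; exact: Qw.
  by move=> k kn; rewrite -[k]/(val (Ordinal kn)) extE ffunE.
split; first by apply: fin_bigcup_measurable => //; exact: finite_finset.
rewrite measure_bigcup_finType//; last first.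
  move=> f g _ _ [w [Ef Eg]]; apply/ffunP => k.
  have [fa fb] := Ef k (ltn_ord k); have [ga gb] := Eg k (ltn_ord k).
  by rewrite -!extE [LHS]surjective_pairing -fa -fb ga gb -surjective_pairing.
rewrite (eq_bigr (fun f : {ffun 'I_n -> 'I_N * 'I_N} =>
    (\prod_(k < n) pair_prob R eC (f k).1 (f k).2)%:E)).
  by rewrite sumEFin /mass bigA_distr_big_dep.
move=> f _; rewrite [LHS]iid.2; congr EFin.
by apply: eq_bigr => k _; rewrite extE.
Qed.

(** Read off the law of a prefix of length one under the trivial predicate, whose event is the whole
    space. *)
Let massT (i0 : 'I_N) : mass predT = 1.
Proof.
have [_] := iid_prefix_law i0 (fun=> predT) 1.
rewrite (_ : [set w | _] = setT); last exact/seteqP.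
by rewrite probability_setT big_ord_recr big_ord0 /= mul1r => -[/esym].
Qed.

Lemma mass_gt0 (Q : pred ('I_N * 'I_N)) z :
  Q z -> eC z.1 z.2 -> 0 < mass Q.
Proof.
move=> Qz ez; have N0 : (0 < N)%N by case: N z.1 => // -[].
rewrite /mass (bigD1 z)//= ltr_pwDl//.
  rewrite /pair_prob ez mulr_gt0// invr_gt0 ltr0n//.
  by apply/card_gt0P; exists z.2; rewrite inE.
apply: sumr_ge0 => y _; rewrite /pair_prob; case: ifP => // _.
Qed.

Section Blocks.
Variables (i0 : 'I_N) (B : nat) (Q : nat -> pred ('I_N * 'I_N)).

Definition block_event (t : nat) : set T :=
  [set w | forall r, (r < B)%N -> Q r (I (t * B + r)%N w, Js (t * B + r)%N w)].

Let win (t k : nat) := (t * B <= k < t * B + B)%N.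

(** The constraint is vacuous outside window t, so a block event becomes a prefix event of any
    sufficient length, and [iid_prefix_law] applies to it. *)
Let Qwin (t k : nat) : pred ('I_N * 'I_N) :=
  fun z => win t k ==> Q (k - t * B)%N z.

Let block_eventE t n : (t * B + B <= n)%N ->
  block_event t = [set w | forall k, (k < n)%N -> Qwin t k (I k w, Js k w)].
Proof.
move=> tn; apply/seteqP; split => w H.
  move=> k kn; apply/implyP => /andP[tk kt].
  by rewrite -{2 3}(subnKC tk); apply: H; rewrite ltn_subLR.
move=> r rB; have /(H (t * B + r)%N) : (t * B + r < n)%N.
  by apply: leq_trans tn; rewrite ltn_add2l.
by rewrite /Qwin /win leq_addr ltn_add2l rB addKn.
Qed.

Let prod_win t n : (t * B + B <= n)%N ->
  \prod_(k < n) (if win t k then mass (Q (k - t * B)%N) else 1) =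
  \prod_(r < B) mass (Q r).
Proof.
move=> tn.
rewrite -(big_mkord xpredT (fun k => if win t k then mass (Q (k - t * B)%N) else 1)).
rewrite (big_cat_nat (n := (t * B)%N))//=; last first.
  exact: leq_trans (leq_addr _ _) tn.
rewrite (big_cat_nat (n := (t * B + B)%N) (m := (t * B)%N))//= ?leq_addr//.
rewrite big1_seq; last first.
  move=> k /andP[_]; rewrite mem_index_iota /win => /andP[_ kt].
  by rewrite leqNgt kt.
rewrite [X in _ * (_ * X)]big1_seq; last first.
  move=> k /andP[_]; rewrite mem_index_iota /win => /andP[kt _].
  by rewrite [X in _ && X]ltnNge kt andbF.
rewrite mul1r mulr1 -[X in \big[_/_]_(X <= i < _) _]add0n big_addn addKn big_mkord.
apply: eq_bigr => r _; have rB : (r + t * B < t * B + B)%N by rewrite addnC ltn_add2l.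
by rewrite /win addnK leq_addl rB.
Qed.

Let massQwin t k :
  mass (Qwin t k) = if win t k then mass (Q (k - t * B)%N) else 1.
Proof.
case: ifP => tk; first by apply: eq_bigl => z; rewrite /Qwin tk.
by rewrite -(massT i0); apply: eq_bigl => z; rewrite /Qwin tk.
Qed.

Let measurable_block t : measurable (block_event t).
Proof.
by rewrite (block_eventE t _ (leqnn _)); exact: (iid_prefix_law i0 _ _).1.
Qed.

Let prob_block t : P (block_event t) = (\prod_(r < B) mass (Q r))%:E.
Proof.
rewrite (block_eventE t _ (leqnn _)) (iid_prefix_law i0 (Qwin t) _).2.
by congr EFin; rewrite -(prod_win t _ (leqnn _)); apply: eq_bigr => k _.
Qed.

(** Both events are written as prefix events of one common length n. Distinct windows are disjoint,
    so at each time at most one of the two constraints is active and the masses multiply. *)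
Let prob_block2 s t : s != t -> P (block_event s `&` block_event t) =
  (\prod_(r < B) mass (Q r) * \prod_(r < B) mass (Q r))%:E.
Proof.
move=> st; pose n := ((maxn s t).+1 * B)%N.
have sn : (s * B + B <= n)%N by rewrite /n addnC -mulSn leq_mul2r ltnS leq_maxl orbT.
have tn : (t * B + B <= n)%N by rewrite /n addnC -mulSn leq_mul2r ltnS leq_maxr orbT.
have -> : block_event s `&` block_event t = [set w | forall k, (k < n)%N ->
    (fun z => Qwin s k z && Qwin t k z) (I k w, Js k w)].
  rewrite (block_eventE s n sn) (block_eventE t n tn).
  apply/seteqP; split => w; first by move=> [Hs Ht] k kn; rewrite Hs ?Ht.
  by move=> H; split => k kn; have /andP[] := H k kn.
rewrite (iid_prefix_law i0 (fun k z => Qwin s k z && Qwin t k z) n).2.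
congr EFin; rewrite -{1}(prod_win s n sn) -(prod_win t n tn) -big_split /=.
apply: eq_bigr => k _; rewrite -!massQwin.
have [ks|ks] := boolP (win s k).
  have kt : win t k = false.
    apply/negP => kt; move: ks kt; rewrite /win => /andP[? ?] /andP[? ?].
    by move/eqP: st; nia.
  rewrite [X in _ * X]massQwin kt mulr1.
  by apply: eq_bigl => z; rewrite [Qwin t k z]/Qwin kt andbT.
rewrite [X in X * _]massQwin (negPf ks) mul1r.
by apply: eq_bigl => z; rewrite [Qwin s k z]/Qwin (negPf ks).
Qed.

Lemma block_frequency : {ae P, forall w,
  (fun n => (\sum_(t < n) \1_(block_event t) w) / n%:R) @ \oo -->
    \prod_(r < B) mass (Q r)}.
Proof. exact: pairwise_indep_slln. Qed.
End Blocks.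
End IID.

(** * One iteration, entrywise *)

Section Positions.
Context {N : nat} (e : rel 'I_N).

Lemma sum_nat_strict_sub (P Q : pred 'I_N) (f : 'I_N -> nat) x :
  subpred P Q -> Q x -> ~~ P x ->
  (\sum_(l | P l) f l + f x <= \sum_(l | Q l) f l)%N.
Proof.
move=> PQ Qx nPx; rewrite (bigD1 x Qx) /= addnC leq_add2l.
rewrite big_mkcond [X in (_ <= X)%N]big_mkcond /=; apply: leq_sum => l _.
case: ifP => // Pl; rewrite (PQ _ Pl) /=.
by have -> : l != x by apply: contraNneq nPx => <-.
Qed.

Lemma sum_Bmat i : (\sum_(l < N) Bmat e i l = mdeg e i)%N.
Proof.
rewrite /Bmat big_split /= /mdeg -addn1; congr addn.
  rewrite -sum1_card [RHS]big_mkcond /=.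
  by apply: eq_bigr => l _; rewrite inE; case: (e i l).
by rewrite (bigD1 i)//= eqxx big1 ?addn0// => l /negPf; rewrite eq_sym => ->.
Qed.

Lemma Bmat_gt0 i j : Ntil e i j -> (0 < Bmat e i j)%N.
Proof. by rewrite /Bmat /Ntil eq_sym => /orP[->|->]; rewrite ?addn_gt0 ?orbT. Qed.

Lemma spos_bounds i j : Ntil e i j ->
  (\sum_(r < N | (r < i)%N) mdeg e r < spos e i j <=
    \sum_(r < N | (r < i)%N) mdeg e r + mdeg e i)%N.
Proof.
move=> ij; rewrite /spos addnC -[X in (X < _)%N]addn0 ltn_add2l leq_add2l.
rewrite (bigD1 j)//= ltn_addr ?Bmat_gt0//=.
rewrite -(bigD1 j (P := fun l : 'I_N => (l <= j)%N))//= -sum_Bmat.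
by rewrite [X in (_ <= X)%N](bigID (fun l : 'I_N => (l <= j)%N)) /= leq_addr.
Qed.

(** Positions follow the lexicographic order on (i, j): by [spos_bounds] row i fills the interval
    right after the earlier rows, and inside a row each admissible j adds a positive [Bmat] term. *)
Lemma spos_inj i j i' j' : Ntil e i j -> Ntil e i' j' ->
  spos e i j = spos e i' j' -> i = i' /\ j = j'.
Proof.
have step_lt (i1 i2 j1 j2 : 'I_N) : Ntil e i1 j1 -> Ntil e i2 j2 ->
    (i1 < i2)%N -> (spos e i1 j1 < spos e i2 j2)%N.
  move=> h1 h2 lt12; have /andP[_ b1] := spos_bounds i1 j1 h1.
  have /andP[b2 _] := spos_bounds i2 j2 h2.
  apply: leq_ltn_trans b1 (leq_ltn_trans _ b2).
  apply: sum_nat_strict_sub => //; last by rewrite ltnn.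
  by move=> l /= /ltn_trans; apply.
have step_lt2 (k j1 j2 : 'I_N) : Ntil e k j2 ->
    (j1 < j2)%N -> (spos e k j1 < spos e k j2)%N.
  move=> h2 lt12; rewrite /spos ltn_add2r.
  apply: leq_trans (sum_nat_strict_sub
    (fun l => l <= j1)%N (fun l => l <= j2)%N (Bmat e k) j2 _ _ _) => //.
  - by rewrite -addn1 leq_add2l Bmat_gt0.
  - by move=> l /= /leq_trans; apply; exact: ltnW.
  - by rewrite -ltnNge.
move=> h h' E; have ii : i = i'.
  apply/val_inj/eqP => /=; rewrite eqn_leq; apply/andP; split; rewrite leqNgt.
    by apply/negP => /(step_lt _ _ _ _ h' h); rewrite E ltnn.
  by apply/negP => /(step_lt _ _ _ _ h h'); rewrite E ltnn.
split=> //; move: h' E; rewrite -ii => h' E.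
apply/val_inj/eqP => /=; rewrite eqn_leq; apply/andP; split; rewrite leqNgt.
  by apply/negP => /(step_lt2 _ _ _ h); rewrite E ltnn.
by apply/negP => /(step_lt2 _ _ _ h'); rewrite E ltnn.
Qed.

Lemma spos_pred_lt i j : Ntil e i j -> ((spos e i j).-1 < mdim e)%N.
Proof.
move=> ij; have /andP[b1 b2] := spos_bounds i j ij.
rewrite prednK; last by apply: leq_ltn_trans b1.
apply: leq_trans b2 _; rewrite /mdim.
by apply: sum_nat_strict_sub => //; rewrite ltnn.
Qed.
End Positions.

Section Entries.
Context {R : realType} {N : nat} (e : rel 'I_N).

(** [spos] counts from 1 while matrix rows count from 0, hence the predecessor; it loses nothing
    because [spos] is positive. *)
Lemma Evec_delta i j (ij : Ntil e i j) :
  Evec R e i j = delta_mx (Ordinal (spos_pred_lt e i j ij)) 0.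
Proof.
apply/colP => p; rewrite !mxE ij eqxx andbT /=.
have /andP[b1 _] := spos_bounds e i j ij.
rewrite -[X in _ == X](prednK (leq_ltn_trans (leq0n _) b1)) eqSS.
by rewrite -val_eqE /=; case: eqP.
Qed.

Lemma entryD (u v : 'cV[R]_(mdim e)) i j :
  entry (u + v) i j = entry u i j + entry v i j :> R.
Proof. by rewrite /entry mulmxDr mxE. Qed.

Lemma entryZ (a : R) (v : 'cV[R]_(mdim e)) i j : entry (a *: v) i j = a * entry v i j.
Proof. by rewrite /entry -scalemxAr mxE. Qed.

Lemma entry_sum (K : finType) (Q : pred K) (F : K -> 'cV[R]_(mdim e)) i j :
  entry (\sum_(k | Q k) F k) i j = \sum_(k | Q k) entry (F k) i j.
Proof. by rewrite /entry mulmx_sumr summxE. Qed.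

Lemma entry_Evec i j i' j' : Ntil e i j -> Ntil e i' j' ->
  entry (Evec R e i' j') i j = ((i == i') && (j == j'))%:R.
Proof.
move=> ij ij'; rewrite /entry (Evec_delta i j ij) (Evec_delta i' j' ij').
rewrite trmx_delta mul_delta_mx_cond -val_eqE /=.
have /andP[b1 _] := spos_bounds e i j ij.
have /andP[b1' _] := spos_bounds e i' j' ij'.
have -> : ((spos e i j).-1 == (spos e i' j').-1) = (i == i') && (j == j').
  apply/eqP/andP => [E|[/eqP-> /eqP->]//].
  have E2 : spos e i j = spos e i' j'.
    rewrite -(prednK (leq_ltn_trans (leq0n _) b1)) E.
    by rewrite (prednK (leq_ltn_trans (leq0n _) b1')).
  by have [-> ->] := spos_inj e i j i' j' ij ij' E2.
by case: andb; rewrite !mxE.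
Qed.

(** Entrywise action of [Wmat]. The rank-one terms for different l touch different columns j, so
    only l = j remains; the difference of the two indicators moves the partners a and b in opposite
    directions, to their common mean. *)
Definition gossip_avg (x : 'I_N -> 'I_N -> R) (a b i j : 'I_N) : R :=
  x i j - 2^-1 * ((ind e a b j)%:R * (x a j - x b j)
                  * ((i == a)%:R - (i == b)%:R)).

Lemma entry_Wmat a b (v : 'cV[R]_(mdim e)) i j : Ntil e i j ->
  entry (Wmat R e a b *m v) i j = gossip_avg (entry v) a b i j.
Proof.
move=> ij; rewrite /Wmat mulmxBl mul1mx entryD -scaleN1r entryZ -scalemxAl entryZ.
rewrite mulN1r; congr (_ - _ * _).
rewrite mulmx_suml entry_sum.
have E l : ind e a b l ->
    entry ((Evec R e a l - Evec R e b l) *m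
           (Evec R e a l - Evec R e b l)^T *m v) i j =
    (entry v a l - entry v b l) * (((i == a) && (j == l))%:R - ((i == b) && (j == l))%:R).
  move=> /andP[al bl].
  rewrite -mulmxA [X in _ *m X]mx11_scalar mul_mx_scalar entryZ.
  rewrite -[- Evec R e b l]scaleN1r entryD entryZ !entry_Evec// mulN1r.
  congr (_ * _); rewrite /entry linearD linearZ /= mulmxDl mxE.
  by rewrite -scalemxAl [X in _ + X]mxE mulN1r.
rewrite (eq_bigr _ E).
have [abj|abj] := boolP (ind e a b j).
  rewrite (bigD1 j)//= eqxx !andbT big1 ?addr0 ?mul1r// => l /andP[_ lj].
  by rewrite [j == l]eq_sym (negPf lj) !andbF subrr mulr0.
rewrite mul0r mul0r big1// => l abl.
have -> : (j == l) = false by apply: contraNF abj => /eqP->.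
by rewrite !andbF subrr mulr0.
Qed.

(** The correction sum in [step] touches diagonal entries only and cancels their averaged value. So
    estimates of others are averaged, while a player's own entry changes through its projected
    gradient step alone. *)
Lemma entry_step (Omega : 'I_N -> set R) (g : 'I_N -> R -> ('I_N -> R) -> R)
    sel k (v : 'cV[R]_(mdim e)) i j : Ntil e i j ->
  let a := (sel k).1 in let b := (sel k).2 in
  entry (step Omega g sel k v) i j =
    if i == j then
      if (i == a) || (i == b) then
        Defs.proj (Omega i) (entry v i i - (nupdates sel k i)%:R^-1 *
          g i (entry v i i) (entry (Wmat R e a b *m v) i))
      else entry v i i
    else gossip_avg (entry v) a b i j.
Proof.
move=> ij a b; rewrite /step entryD entry_sum.
have ii l : Ntil e l l by rewrite /Ntil eqxx.
under eq_bigr do rewrite entryZ entry_Evec//.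
have [<-|nij] := eqVneq i j.
  rewrite (bigD1 i)//= eqxx mulr1 big1 => [|l li]; last first.
    by rewrite [i == l]eq_sym (negPf li) mulr0.
  by rewrite addr0 addrC subrK.
rewrite big1 ?addr0 ?entry_Wmat// => l _.
suff -> : (i == l) && (j == l) = false by rewrite mulr0.
by apply/negP => /andP[/eqP <- /eqP ji]; rewrite ji eqxx in nij.
Qed.
End Entries.

(** * Real sequences *)

Section RealSequences.
Context {R : realType}.

(** Replaces a limit superior: [Q E] is meant as E being an eventual upper bound, and a contraction
    valid up to arbitrarily small losses drives such bounds to 0. *)
Lemma eventually_contract (Q : R -> Prop) (kappa M : R) :
  0 <= kappa < 1 ->
  (forall E E', E <= E' -> Q E -> Q E') ->
  (forall E eta, 0 < eta -> Q E -> Q (kappa * E + eta)) ->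
  Q M -> forall eps, 0 < eps -> Q eps.
Proof.
move=> /andP[k0 k1] Qmono Qstep QM eps eps0.
(* This loss makes eps / 2 the fixed point of E -> kappa E + eta, so the iterates are M kappa^n +
   eps / 2. *)
have eta0 : 0 < (1 - kappa) * (eps / 2) by rewrite mulr_gt0// ?subr_gt0// divr_gt0.
have H n : Q (M * kappa ^+ n + eps / 2).
  elim: n => [|n IH]; first by apply: Qmono QM; rewrite expr0 mulr1 lerDl divr_ge0// ltW.
  apply: Qmono (Qstep _ _ eta0 IH); rewrite exprS; lra.
have k1' : `|kappa| < 1 by rewrite ger0_norm.
have e2 : 0 < eps / 2 by rewrite divr_gt0.
have [n Hn] := (cvg_seqP _ _ _).1 (cvg_geometric M k1') _ e2.
apply: Qmono (H n); move: (Hn n (leqnn n)); rewrite subr0 /geometric /=.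
by move/(le_trans (ler_norm _)); lra.
Qed.

Lemma last_occurrence (y : nat -> bool) n :
  \sum_(t < n) (y t)%:R = 0 :> R \/
  exists s, [/\ (s < n)%N, y s & \sum_(t < n) (y t)%:R = \sum_(t < s.+1) (y t)%:R :> R].
Proof.
elim: n => [|n [IH|[s [sn ys IH]]]]; first by left; rewrite big_ord0.
  have [yn|yn] := boolP (y n); first by right; exists n.
  by left; rewrite big_ord_recr /= IH (negPf yn) addr0.
right; have [yn|yn] := boolP (y n); first by exists n.
exists s; split => //; first exact: ltnW.
by rewrite big_ord_recr /= (negPf yn) addr0.
Qed.

(* The partial sums at n and just after the last occurrence s < n agree, and they
   are close to q * n and q * s. *)
Lemma recent_occurrence (y : nat -> bool) (q : R) : 0 < q ->
  (fun n => (\sum_(t < n) (y t)%:R) / n%:R) @ \oo --> q ->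
  forall eta : R, 0 < eta -> exists n0, forall n, (n0 <= n)%N ->
    exists s, [/\ (s < n)%N, y s & n%:R - s%:R <= eta * n%:R].
Proof.
move=> q0 /cvg_seqP cv eta eta0.
(* The comparison of counts will read (q - eps) n <= (q + eps) (s + 1), that is (q + eps) (n - s) <=
   2 eps n + (q + eps). The bound eps <= eta q / 4 gives half of eta n to the first term; large n
   gives the other half to the second. *)
have [eps [eps0 epsq epseta]] : exists eps : R, [/\ 0 < eps, eps <= q / 2 & 4 * eps <= eta * q].
  exists (Num.min (q / 2) (eta * q / 4)); split.
  - by rewrite lt_min !divr_gt0// mulr_gt0.
  - by rewrite ge_min lexx.
  - by rewrite mulrC -ler_pdivlMr// ge_min lexx orbT.
have [n1 Hn1] := cv _ eps0.
have min0 : 0 < Num.min (eta / 2) (q / 2 / n1.+1%:R) :> R by rewrite lt_min !divr_gt0.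
have [n2 Hn2] := (cvg_seqP _ _ _).1 (@cvg_harmonic R) _ min0.
exists (maxn n1 n2).+1 => n; rewrite gtn_max => /andP[n1n n2n].
have n0 : (0 < n)%N by apply: leq_ltn_trans n1n.
have nR : 0 < n%:R :> R by rewrite ltr0n.
have harm : 1 <= Num.min (eta / 2) (q / 2 / n1.+1%:R) * n%:R.
  rewrite -ler_pdivrMr// mul1r.
  have := Hn2 n.-1; rewrite -ltnS prednK// => /(_ n2n).
  by rewrite subr0 /harmonic /= prednK// ger0_norm.
move: (Hn1 n (ltnW n1n)); rewrite ler_norml => /andP[low _].
have low' : (q - eps) * n%:R <= \sum_(t < n) (y t)%:R.
  by rewrite -ler_pdivlMr//; lra.
have [S0|[s [sn ys Ss]]] := last_occurrence y n.
  by move: low'; rewrite S0 leNgt mulr_gt0//; lra.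
exists s; split => //.
have trivial : \sum_(t < s.+1) (y t)%:R <= s.+1%:R :> R.
  apply: (@le_trans _ _ (\sum_(t < s.+1) 1)); last by rewrite sumr_const card_ord.
  by apply: ler_sum => t _; rewrite lern1 leq_b1.
(* The frequency estimate must also hold at s + 1. If s + 1 were below n1, the count would be below
   n1 + 1, whereas it is at least q n / 2. *)
have sn1 : (n1 <= s.+1)%N.
  rewrite leqNgt; apply/negP => lt; move: low'; rewrite Ss leNgt => /negP; apply.
  apply: le_lt_trans trivial _.
  apply: (@lt_le_trans _ _ n1.+1%:R); first by rewrite ltr_nat ltnS ltnW.
  have : q / 2 * n%:R <= (q - eps) * n%:R by rewrite ler_pM2r//; lra.
  apply: le_trans.
  have : 1 <= q / 2 / n1.+1%:R * n%:R.
    by apply: le_trans harm _; rewrite ler_pM2r// ge_min lexx orbT.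
  by rewrite mulrAC ler_pdivlMr// mul1r.
have sR : 0 < s.+1%:R :> R by [].
move: (Hn1 _ sn1); rewrite ler_norml => /andP[_ up].
have up' : \sum_(t < s.+1) (y t)%:R <= (q + eps) * s.+1%:R.
  by rewrite -ler_pdivrMr//; move: up; set X := _ / _; lra.
have harm' : 1 <= eta / 2 * n%:R.
  by apply: le_trans harm _; rewrite ler_pM2r// ge_min lexx.
have : (q - eps) * n%:R <= (q + eps) * s.+1%:R.
  by apply: le_trans low' _; rewrite Ss.
rewrite -(natr1 s) => main.
have qe : 0 < q + eps by lra.
rewrite -(ler_pM2l qe).
have h1 : 2 * eps * n%:R <= eta * q / 2 * n%:R by rewrite ler_pM2r//; lra.
have h2 : (q + eps) * 1 <= (q + eps) * (eta / 2 * n%:R) by rewrite ler_pM2l.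
have h3 : 0 <= eps * (eta / 2 * n%:R) by rewrite !mulr_ge0// ltW// divr_gt0.
nra.
Qed.

(** Both sides come from ln (1 + x) <= x, at x = 1/n and at x = -1/(n+1); the error is 1/n -
    1/(n+1). *)
Lemma ln_succ_bounds (n : nat) : (0 < n)%N ->
  0 <= ln (n.+1%:R : R) - ln n%:R - (n.+1%:R)^-1 <= (n%:R * n.+1%:R)^-1.
Proof.
move=> n0; have nR : 0 < n%:R :> R by rewrite ltr0n.
have nR1 : 0 < n.+1%:R :> R by [].
have E : n.+1%:R = n%:R + 1 :> R by rewrite natr1.
have up : ln n.+1%:R - ln n%:R <= n%:R^-1 :> R.
  rewrite -ln_div ?posrE// E mulrDl divff ?gt_eqF// mul1r.
  by apply: le_ln1Dx; apply: (@lt_trans _ _ 0) => //; rewrite ?oppr_lt0// invr_gt0.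
have low : ln n%:R - ln n.+1%:R <= - (n.+1%:R)^-1 :> R.
  rewrite -ln_div ?posrE//.
  have -> : n%:R / n.+1%:R = 1 + - (n.+1%:R)^-1 :> R by rewrite E; field; lra.
  by apply: le_ln1Dx; rewrite ltrN2 invf_lt1// E; lra.
have -> : (n%:R * n.+1%:R)^-1 = n%:R^-1 - (n.+1%:R)^-1 :> R.
  by rewrite E; field; apply/andP; split; lra.
move: up low; move: (ln n.+1%:R) (n.+1%:R)^-1 => a b up low.
by apply/andP; split; lra.
Qed.

(** As long as [U] >= 2 eps, [V] >= eps and [U] loses at least c / (k+1) per step; the harmonic
    series diverges, so [U] must fall below 2 eps. From then on [U] stays below 3 eps: it rises by
    at most eps when below 2 eps and decreases otherwise. Hence [V] <= 4 eps. *)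
Lemma harmonic_descent (U V Phi : nat -> R) :
  (forall eps : R, 0 < eps -> exists k0, forall k, (k0 <= k)%N ->
    U k.+1 <= U k - 2 * Phi k / k.+1%:R + eps / k.+1%:R) ->
  (forall eps : R, 0 < eps -> exists k0, forall k, (k0 <= k)%N -> `|U k - V k| <= eps) ->
  (forall eps : R, 0 < eps -> exists2 c, 0 < c & forall k, eps <= V k -> c <= Phi k) ->
  (forall k, 0 <= Phi k) ->
  forall eps : R, 0 < eps -> exists k0, forall k, (k0 <= k)%N -> V k <= eps.
Proof.
move=> Hdesc Hclose Hcoer Phi0 eps0 eps00.
have [eps e0 ->] : exists2 eps, 0 < eps & eps0 = 4 * eps.
  by exists (eps0 / 4); [rewrite divr_gt0|field].
have [c c0 Hc] := Hcoer _ e0.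
(* The error must use at most half of the descent 2 c, and must not lift [U] by more than eps in one
   step. *)
have m0 : 0 < Num.min c eps by rewrite lt_min c0.
have [k1 Hk1] := Hdesc _ m0; have [k2 Hk2] := Hclose _ e0.
pose K := maxn k1 k2.
have close k : (K <= k)%N -> `|U k - V k| <= eps.
  by rewrite geq_max => /andP[_]; exact: Hk2.
have desc k : (K <= k)%N -> U k.+1 <= U k - 2 * Phi k / k.+1%:R + Num.min c eps / k.+1%:R.
  by rewrite geq_max => /andP[? _]; exact: Hk1.
have big k : (K <= k)%N -> 2 * eps <= U k -> U k.+1 <= U k - c / k.+1%:R.
  move=> Kk Uk; have Vk : eps <= V k.
    by move: (close k Kk); rewrite ler_norml => /andP[_]; lra.
  apply: le_trans (desc k Kk) _.
  rewrite -addrA lerD2l -!mulNr -mulrDl ler_pM2r ?invr_gt0//.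
  have : Num.min c eps <= c by rewrite ge_min lexx.
  by move: (Hc _ Vk); lra.
have small k : (K <= k)%N -> U k < 2 * eps -> U k.+1 <= 3 * eps.
  move=> Kk Uk; apply: le_trans (desc k Kk) _.
  have h1 : 0 <= 2 * Phi k / k.+1%:R by rewrite !mulr_ge0 ?invr_ge0.
  have h2 : Num.min c eps / k.+1%:R <= eps.
    rewrite ler_pdivrMr//; apply: (@le_trans _ _ (eps * 1)).
      by rewrite mulr1 ge_min lexx orbT.
    by rewrite ler_pM2l// ler1n.
  move: h1 h2; move: (2 * Phi k / _) (Num.min c eps / _) => a b; lra.
have [k3 Kk3 Uk3] : exists2 k3, (K <= k3)%N & U k3 < 2 * eps.
  apply: contrapT => no.
  have all_big k : (K <= k)%N -> 2 * eps <= U k.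
    by move=> Kk; rewrite leNgt; apply/negP => lt; apply: no; exists k.
  have bnd n : U (K + n)%N <= U K - c * (series harmonic (K + n)%N - series harmonic K).
    elim: n => [|n IH]; first by rewrite addn0 subrr mulr0 subr0.
    rewrite addnS; apply: le_trans (big _ (leq_addr _ _) (all_big _ (leq_addr _ _))) _.
    rewrite seriesSr /= mulrBr mulrDr; move: IH; rewrite mulrBr /harmonic /=.
    by move: (series _ _) (series _ _) (_^-1) => a b h; lra.
  apply: (@dvg_harmonic R); apply: nondecreasing_is_cvgn.
    by apply: nondecreasing_series => n _ _; exact: harmonic_ge0.
  exists (series harmonic K + U K / c) => _ [n _ <-].
  apply: (@le_trans _ _ (series harmonic (K + n)%N)).
    apply: nondecreasing_series => [m _ _|]; first exact: harmonic_ge0.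
    exact: leq_addl.
  rewrite -lerBlDl ler_pdivlMr// mulrC.
  by move: (bnd n) (all_big (K + n)%N (leq_addr _ _)); lra.
have U3 n : U (k3 + n)%N <= 3 * eps.
  elim: n => [|n IH]; first by rewrite addn0; lra.
  rewrite addnS; have Kn : (K <= k3 + n)%N by apply: leq_trans Kk3 (leq_addr _ _).
  have [lt|ge] := ltP (U (k3 + n)%N) (2 * eps); first exact: small.
  apply: le_trans (big _ Kn ge) _.
  have : 0 <= c / (k3 + n).+1%:R by rewrite divr_ge0// ltW.
  by move: (c / _) => a; lra.
exists k3 => k k3k; move: (U3 (k - k3)%N); rewrite subnKC// => Uk.
have := close k (leq_trans Kk3 k3k); rewrite ler_norml => /andP[]; lra.
Qed.
End RealSequences.

(** * Projections and the game *)

Section Projection.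
Context {R : realType} (S : set R).
Hypotheses (S0 : S !=set0) (cS : compact S).

(** Compactness provides a nearest point, so [xget] does not fall back on its default 0. *)
Lemma projP y : S (Defs.proj S y) /\ forall q, S q -> `|y - Defs.proj S y| <= `|y - q|.
Proof.
have cf : {within S, continuous (fun q => `|y - q|)}.
  apply: continuous_subspaceT => q; apply: cvg_norm.
  by apply: cvgB; [exact: cvg_cst|exact: cvg_id].
have [p pS pmin] := compact_EVT_min S0 cS cf.
rewrite /Defs.proj.
apply: (@xgetPex _ 0 [set p | S p /\ forall q, S q -> `|y - p| <= `|y - q|]).
exists p; split; first by rewrite inE in pS.
by move=> q Sq; apply: pmin; rewrite inE.
Qed.

Hypothesis convS : convex_set_R S.

(** It suffices that (y - p)(s - p) <= 0. On the line y - p = r (s - p); if r > 0, then either y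
    lies between p and s, so y is in S and is its own nearest point, or s lies between p and y and
    is nearer to y than p. *)
Lemma proj_sqr_le y s : S s -> (Defs.proj S y - s) ^+ 2 <= (y - s) ^+ 2.
Proof.
move=> Ss; have [Sp pmin] := projP y; move: (Defs.proj S y) Sp pmin => p Sp pmin.
suff H : (y - p) * (s - p) <= 0.
  rewrite -subr_ge0.
  have -> : (y - s) ^+ 2 - (p - s) ^+ 2 =
    (y - p) ^+ 2 - 2 * ((y - p) * (s - p)) by ring.
  by have := sqr_ge0 (y - p); lra.
rewrite leNgt; apply/negP => H.
have a0 : s - p != 0 by apply: contraTneq H => ->; rewrite mulr0 ltxx.
pose r := (y - p) / (s - p).
have yE : y - p = r * (s - p) by rewrite /r divfK.
have r0 : 0 < r.
  by rewrite -(pmulr_lgt0 _ (_ : 0 < (s - p) ^+ 2)) ?exprn_even_gt0// expr2 mulrA -yE.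
move: r yE r0 => r yE r0.
have apos : 0 < `|s - p| by rewrite normr_gt0.
have [r1|r1] := leP r 1.
  have Sy : S y.
    have -> : y = r * s + (1 - r) * p by rewrite -[LHS](subrK p) yE; ring.
    by apply: convS => //; rewrite r1 ltW.
  have := pmin _ Sy; rewrite subrr normr0 normr_le0 yE mulf_eq0 (negPf a0) orbF.
  by move/eqP => r00; rewrite r00 ltxx in r0.
have := pmin _ Ss.
have -> : y - s = (r - 1) * (s - p).
  by rewrite mulrBl -yE; ring.
rewrite yE !normrM ler_pM2r// !ger0_norm; lra.
Qed.

Lemma proj_norm_le y s : S s -> `|Defs.proj S y - s| <= `|y - s|.
Proof.
move=> Ss; rewrite -ler_sqr ?nnegrE// !real_normK ?num_real//.
exact: proj_sqr_le.
Qed.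
End Projection.

Section GameFacts.
Context {R : realType} {N : nat} (e : rel 'I_N) (Omega : 'I_N -> set R).
Context (J g : 'I_N -> R -> ('I_N -> R) -> R) (sigma L : 'I_N -> R).
Hypothesis ga : game_assumptions e Omega J g sigma L.

Lemma actions_bounded :
  exists2 M, 0 <= M & forall i x y, Omega i x -> Omega i y -> `|x - y| <= M.
Proof.
have [+ _ _ _ _] := ga => hO.
have H i : exists Mi : R, 0 <= Mi /\ forall x, Omega i x -> `|x| <= Mi.
  have [_ [/compact_bounded/ex_strict_bound_gt0[M M0 HM] _]] := hO i.
  by exists M; split; [exact: ltW|move=> x /HM /ltW].
have [M HM] := choice H.
exists (2 * \sum_i M i).
  by rewrite mulr_ge0// sumr_ge0// => i _; case: (HM i).
move=> i x y Ox Oy; apply: le_trans (ler_normB _ _) _.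
have : M i <= \sum_i M i.
  by rewrite (bigD1 i)//= lerDl sumr_ge0// => j _; case: (HM j).
by move: ((HM i).2 _ Ox) ((HM i).2 _ Oy); lra.
Qed.

Lemma gradient_lipschitz : exists2 K, 0 < K & forall i x y u v (eta : R),
  Omega i x -> Omega i y -> in_Omega_minus e Omega i u -> in_Omega_minus e Omega i v ->
  `|x - y| <= eta -> (forall j, e i j -> `|u j - v j| <= eta) ->
  `|g i x u - g i y v| <= K * eta.
Proof.
have [_ _ _ _ [_ _ _ _ [hs hL]]] := ga.
(* The factor N passes from the Euclidean norm to the sup norm: a sum of at most N squares, each at
   most eta^2, has root at most N eta. *)
pose k i := sigma i + L i * N%:R.
have k0 i : 0 <= k i.
  by rewrite addr_ge0 ?mulr_ge0 ?(ltW (hs i).1) ?(ltW (hL i).1).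
exists (1 + \sum_i k i); first by rewrite ltr_pwDl// sumr_ge0.
move=> i x y u v eta Ox Oy Ou Ov xy uv.
have eta0 : 0 <= eta by apply: le_trans xy.
have -> : g i x u - g i y v = (g i x u - g i y u) + (g i y u - g i y v) by ring.
apply: le_trans (ler_normD _ _) _.
have h1 : `|g i x u - g i y u| <= sigma i * eta.
  by apply: le_trans ((hs i).2 _ _ _ Ou Ox Oy) _; rewrite ler_pM2l//; exact: (hs i).1.
have h2 : `|g i y u - g i y v| <= L i * N%:R * eta.
  apply: le_trans ((hL i).2 _ _ _ Oy Ou Ov) _.
  rewrite -mulrA ler_pM2l; last exact: (hL i).1.
  rewrite -[X in _ <= X]ger0_norm ?mulr_ge0// -sqrtr_sqr ler_wsqrtr//.
  apply: (@le_trans _ _ (\sum_(j < N) eta ^+ 2)).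
    rewrite big_mkcond /=; apply: ler_sum => j _; case: ifP => [eij|_]; last exact: sqr_ge0.
    by rewrite -[X in X <= _]real_normK ?num_real// ler_sqr ?nnegrE// uv.
  rewrite sumr_const card_ord -[X in X <= _]mulr_natl exprMn ler_wpM2r ?sqr_ge0//.
  by rewrite expr2 -natrM ler_nat; case: (N) => // n; rewrite leq_pmulr.
have : k i <= \sum_i k i by rewrite (bigD1 i)//= lerDl sumr_ge0.
rewrite /k => ki; have := ler_wpM2r eta0 ki; lra.
Qed.

Lemma gradient_bounded (xs : 'I_N -> R) : in_Omega Omega xs ->
  exists2 G, 0 < G & forall i x u, Omega i x -> in_Omega_minus e Omega i u ->
    `|g i x u| <= G.
Proof.
move=> Oxs; have [M M0 HM] := actions_bounded; have [K K0 HK] := gradient_lipschitz.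
exists (1 + \sum_i `|g i (xs i) xs| + K * M).
  by rewrite -addrA ltr_pwDl// addr_ge0 ?sumr_ge0// mulr_ge0// ltW.
move=> i x u Ox Ou.
have h1 : `|g i x u - g i (xs i) xs| <= K * M.
  apply: HK => //; first exact: (HM i _ _ Ox (Oxs i)).
  by move=> j eij; exact: (HM j _ _ (Ou j eij) (Oxs j)).
have h2 : `|g i (xs i) xs| <= \sum_i `|g i (xs i) xs|.
  by rewrite (bigD1 i)//= lerDl sumr_ge0.
have -> : g i x u = (g i x u - g i (xs i) xs) + g i (xs i) xs by ring.
by apply: le_trans (ler_normD _ _) _; lra.
Qed.

Section Nash.
Variable xs : 'I_N -> R.
Hypothesis nash : nash_equilibrium Omega J xs.

(** First-order optimality along the segment from [xs i] to y. By minimality a difference quotient q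
    towards y satisfies q (y - xs i) >= 0; were the claim false, q near the gradient would have its
    sign, which is opposite to that of y - xs i. *)
Lemma nash_variational i y : Omega i y -> 0 <= g i (xs i) xs * (y - xs i).
Proof.
move=> Oy; have [Oxs Jmin] := nash.
have [hO _ _ hder _] := ga; have [_ [_ convO]] := hO i.
have := hder i xs (xs i) (fun j _ => Oxs j) (Oxs i).
set gi := g i (xs i) xs => cv.
rewrite leNgt; apply/negP => neg.
have w0 : y - xs i != 0 by apply: contraTneq neg => ->; rewrite mulr0 ltxx.
have g0 : 0 < `|gi|.
  by rewrite normr_gt0; apply: contraTneq neg => ->; rewrite mul0r ltxx.
(* A quotient at distance less than [|gi|] from [gi] has the same strict sign as [gi]. *)
move/cvgrPdist_lt : cv => /(_ _ g0).
rewrite /within /= => /nbhs_ballP[delta /= delta0 Hd].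
have aw0 : 0 < `|y - xs i| by rewrite normr_gt0.
pose t := Num.min 1 (delta / 2 / `|y - xs i|).
have t0 : 0 < t by rewrite lt_min ltr01 !divr_gt0.
have t1 : t <= 1 by rewrite ge_min lexx.
have td : t * `|y - xs i| < delta.
  apply: (@le_lt_trans _ _ (delta / 2)); last by move: (delta) delta0 => dd; lra.
  by rewrite -ler_pdivlMr// ge_min lexx orbT.
pose z := t * y + (1 - t) * xs i.
have Oz : Omega i z by apply: convO => //; rewrite t1 ltW.
have zx : z - xs i = t * (y - xs i) by rewrite /z; ring.
have bz : ball (xs i) delta z.
  by rewrite -ball_normE /ball_ /= distrC zx normrM (gtr0_norm t0).
have zne : z != xs i by rewrite -subr_eq0 zx mulf_neq0// gt_eqF.
have := Hd z bz zne Oz; rewrite zx.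
set q := _ / _ => qlt.
have qw : 0 <= q * (y - xs i).
  have -> : q * (y - xs i) = (J i z xs - J i (xs i) xs) / t.
    by rewrite /q; field; rewrite w0 gt_eqF.
  by rewrite divr_ge0 ?subr_ge0 ?(ltW t0)// Jmin.
have : (gi - q) ^+ 2 < gi ^+ 2.
  rewrite -[X in X < _]real_normK ?num_real// -[X in _ < X]real_normK ?num_real//.
  by rewrite ltr_sqr ?nnegrE.
move=> sq; have gq : 0 < gi * q by nra.
have w2 : 0 < (y - xs i) ^+ 2 by rewrite exprn_even_gt0.
have : 0 < (gi * (y - xs i)) * (q * (y - xs i)).
  have -> : (gi * (y - xs i)) * (q * (y - xs i)) = gi * q * (y - xs i) ^+ 2 by ring.
  exact: mulr_gt0.
nra.
Qed.

Lemma pairing_ge0 x : in_Omega Omega x ->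
  0 <= \sum_i g i (x i) x * (x i - xs i).
Proof.
move=> Ox; have [->|nx] := pselect (x = xs).
  by rewrite big1// => i _; rewrite subrr mulr0.
have [_ _ _ _ [_ _ _ hm _]] := ga.
apply: le_trans (ltW (hm _ _ Ox nash.1 nx)) _.
apply: ler_sum => i _; rewrite mulrBl gerBl.
exact/nash_variational/Ox.
Qed.

(** Strict monotonicity makes the pairing f of gradient differences positive away from x*. On the
    compact set of profiles at squared distance at least eps it attains a positive minimum, and the
    variational inequality shows that f bounds the required pairing from below. *)
Lemma pairing_coercive (eps : R) : 0 < eps -> exists2 c, 0 < c &
  forall x, in_Omega Omega x -> eps <= \sum_i (x i - xs i) ^+ 2 ->
    c <= \sum_i g i (x i) x * (x i - xs i).
Proof.
move=> eps0; have [Oxs _] := nash.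
pose f (v : 'rV[R]_N) := \sum_i (g i (v 0 i) (v 0) - g i (xs i) xs) * (v 0 i - xs i).
pose box := [set v : 'rV[R]_N | forall i, Omega i (v 0 i)].
pose far := [set v : 'rV[R]_N | eps <= \sum_i (v 0 i - xs i) ^+ 2].
have [hO _ _ _ [_ _ _ hm _]] := ga.
have cbox : compact box by apply: rV_compact => i; case: (hO i) => _ [].
have coordF (F : set_system 'rV[R]_N) (FF : Filter F) (w : 'rV[R]_N) i :
    F --> nbhs w -> (fun v : 'rV[R]_N => v 0 i - xs i) @ F --> w 0 i - xs i.
  move=> Fw; apply: cvgB; last exact: cvg_cst.
  exact: (cvg_trans (cvg_fmap2 Fw) (@coord_continuous R 1 N 0 i w)).
have sumF (F : set_system 'rV[R]_N) (FF : Filter F) (h : 'I_N -> 'rV[R]_N -> R) l :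
    (forall i, h i @ F --> l i) -> (fun v => \sum_i h i v) @ F --> (\sum_i l i : R).
  by move=> hl; apply: cvg_big => //; exact: add_continuous.
have cfar : closed far.
  rewrite (_ : far = (fun v : 'rV[R]_N => \sum_i (v 0 i - xs i) ^+ 2)
    @^-1` [set r | eps <= r])//.
  apply: closed_comp; last exact: closed_ge.
  move=> v _; apply: (sumF (nbhs v) _ (fun i v => (v 0 i - xs i) ^+ 2)) => i.
  by have c := coordF (nbhs v) (nbhs_filter v) v i (fun=> id); exact: (cvgM c c).
have cK : compact (box `&` far) by exact: compact_closedI.
have bound (x : 'I_N -> R) : in_Omega Omega x ->
    f (\row_i x i) <= \sum_i g i (x i) x * (x i - xs i).
  move=> Ox; apply: ler_sum => i _.
  have -> : (\row_i x i) 0 = x by apply/funext => j; rewrite mxE.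
  by rewrite mulrBl gerBl nash_variational.
have [[v0 Kv0]|none] := pselect (box `&` far !=set0); last first.
  (* No profile is that far from x*, so any positive constant serves. *)
  exists 1 => // x Ox far_x; exfalso; apply: none; exists (\row_i x i); split.
    by move=> i; rewrite mxE.
  by rewrite /far /=; under eq_bigr do rewrite mxE.
have cf : {within box `&` far, continuous f}.
  apply/subspace_continuousP => w [bw fw].
  apply: (sumF (within (box `&` far) (nbhs w)) _
    (fun i v => (g i (v 0 i) (v 0) - g i (xs i) xs) * (v 0 i - xs i))) => i.
  apply: cvgM; last exact: (coordF _ (within_filter _ (nbhs_filter w)) w i (cvg_within _)).
  apply: cvgB; last exact: cvg_cst.
  have [K K0 HK] := gradient_lipschitz.
  apply/cvgrPdist_le => eta eta0.
  have eK : 0 < eta / K by rewrite divr_gt0.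
  have near_w : nbhs w [set v : 'rV[R]_N | forall j, `|w 0 j - v 0 j| <= eta / K].
    apply: (@filter_forall _ _ (fun j (v : 'rV[R]_N) =>
      `|w 0 j - v 0 j| <= eta / K) _ (nbhs_filter w)) => j.
    by have /cvgrPdist_le/(_ _ eK) := @coord_continuous R 1 N 0 j w.
  rewrite /within /=; apply: filterS near_w => v vw [bv _].
  rewrite -[eta](divfK (lt0r_neq0 K0)) mulrC.
  apply: HK => //.
have [c] := compact_EVT_min (ex_intro _ v0 Kv0) cK cf.
rewrite inE => -[bc fc] cmin; exists (f c).
  apply: (hm (c 0) xs) => // cx; move: fc; rewrite /far /= cx big1 ?leNgt ?eps0// => i _.
  by rewrite subrr expr0n.
move=> x Ox far_x; apply: le_trans (bound _ Ox); apply: cmin.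
rewrite inE; split; first by move=> i; rewrite mxE.
by rewrite /far /=; under eq_bigr do rewrite mxE.
Qed.
End Nash.
End GameFacts.

(** * Consensus of the estimates *)

Section Consensus.
Context {R : realType} {N : nat} (e : rel 'I_N).
Context (X : nat -> 'I_N -> 'I_N -> R) (sel : nat -> 'I_N * 'I_N).
Hypothesis XS : forall k i j, Ntil e i j -> i != j ->
  X k.+1 i j = gossip_avg e (X k) (sel k).1 (sel k).2 i j.

Lemma gossip_avg_in (x : 'I_N -> 'I_N -> R) a b i j :
  ind e a b j -> (i == a) || (i == b) ->
  gossip_avg e x a b i j = (x a j + x b j) / 2.
Proof.
rewrite /gossip_avg => -> /=; have [<-|ab] := eqVneq a b.
  by rewrite orbb => /eqP ->; rewrite eqxx; field.
move=> /orP[] /eqP ->; first by rewrite eqxx (negPf ab) /=; field.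
by rewrite eqxx [b == a]eq_sym (negPf ab) /=; field.
Qed.

Lemma gossip_avg_out (x : 'I_N -> 'I_N -> R) a b i j :
  ~~ (ind e a b j && ((i == a) || (i == b))) -> gossip_avg e x a b i j = x i j.
Proof.
rewrite /gossip_avg negb_and negb_or => /orP[/negPf ->|/andP[/negPf -> /negPf ->]].
  by rewrite !mul0r mulr0 subr0.
by rewrite subrr !mulr0 subr0.
Qed.

(** Disagreement is measured against the leader's current entry, which moves by at most tau per step
    in the lemmas below. *)
Let dis k i j := `|X k i j - X k j j|.

Let dis_diag k j : dis k j j = 0.
Proof. by rewrite /dis subrr normr0. Qed.

Let dis_avg k i j tau D1 D2 : Ntil e i j -> i != j ->
  `|X k.+1 j j - X k j j| <= tau ->
  ind e (sel k).1 (sel k).2 j -> (i == (sel k).1) || (i == (sel k).2) ->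
  dis k (sel k).1 j <= D1 -> dis k (sel k).2 j <= D2 ->
  dis k.+1 i j <= (D1 + D2) / 2 + tau.
Proof.
move=> ij nij dr indj iab h1 h2; rewrite /dis XS// gossip_avg_in//.
set a := (sel k).1; set b := (sel k).2.
have -> : (X k a j + X k b j) / 2 - X k.+1 j j =
  ((X k a j - X k j j) + (X k b j - X k j j)) / 2 - (X k.+1 j j - X k j j) by field.
apply: le_trans (ler_normB _ _) _; apply: lerD => //.
rewrite normrM [X in _ * X]ger0_norm ?invr_ge0// ler_pM2r ?invr_gt0//.
by apply: le_trans (ler_normD _ _) _; apply: lerD.
Qed.

(** The weak level (D' + D) / 2 covers every case: without averaging D' is already below it, and
    averaging with an arbitrary partner mixes D' with at most D. *)
Let dis_keep k i j tau D D' : Ntil e i j ->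
  `|X k.+1 j j - X k j j| <= tau -> 0 <= D' <= D ->
  (forall l, Ntil e l j -> dis k l j <= D) -> dis k i j <= D' ->
  dis k.+1 i j <= (D' + D) / 2 + tau.
Proof.
move=> ij dr /andP[D'0 D'D] hD hi.
have tau0 : 0 <= tau by apply: le_trans dr.
have [->|nij] := eqVneq i j; first by rewrite dis_diag; lra.
have [/andP[indj iab]|out] := boolP (ind e (sel k).1 (sel k).2 j &&
    ((i == (sel k).1) || (i == (sel k).2))); last first.
  rewrite /dis XS// gossip_avg_out//.
  have -> : X k i j - X k.+1 j j = (X k i j - X k j j) - (X k.+1 j j - X k j j) by ring.
  apply: le_trans (ler_normB _ _) _; apply: lerD => //.
  by apply: le_trans hi _; lra.
have /andP[aj bj] := indj.
move: (iab) => /orP[/eqP ia|/eqP ib].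
  by apply: dis_avg => //; rewrite -?ia// hD.
by rewrite [D' + D]addrC; apply: dis_avg => //; rewrite -?ib// hD.
Qed.

(** Information passes along the edge: the second partner reaches the level that [dis_keep]
    guarantees for the informed first one. *)
Let dis_spread k j tau D D' :
  ind e (sel k).1 (sel k).2 j ->
  `|X k.+1 j j - X k j j| <= tau -> 0 <= D' <= D ->
  (forall l, Ntil e l j -> dis k l j <= D) -> dis k (sel k).1 j <= D' ->
  dis k.+1 (sel k).2 j <= (D' + D) / 2 + tau.
Proof.
move=> indj dr /andP[D'0 D'D] hD hi.
have tau0 : 0 <= tau by apply: le_trans dr.
have [->|nij] := eqVneq (sel k).2 j; first by rewrite dis_diag; lra.
have /andP[aj bj] := indj.
by apply: dis_avg => //; rewrite ?eqxx ?orbT ?hD.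
Qed.

(** Case D' = D of [dis_keep], iterated: whatever pairs are selected, a uniform bound worsens only
    by the drift of the leaders. *)
Let dis_drift k s tau D :
  (forall r, (r < s)%N -> forall j, `|X (k + r).+1 j j - X (k + r)%N j j| <= tau) ->
  (forall i j, Ntil e i j -> dis k i j <= D) ->
  forall i j, Ntil e i j -> dis (k + s)%N i j <= D + s%:R * tau.
Proof.
elim: s => [|s IH] hdr hD i j ij; first by rewrite addn0 mul0r addr0 hD.
have {}IH := IH (fun r rs => hdr r (ltnW rs)) hD.
have b0 : 0 <= D + s%:R * tau by exact: le_trans (normr_ge0 _) (IH i j ij).
have := dis_keep (k + s)%N i j tau (D + s%:R * tau) (D + s%:R * tau) ij
  (hdr s (ltnSn s) j).
rewrite lexx b0 => /(_ isT (fun l lj => IH l j lj) (IH i j ij)).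
by rewrite addnS => /le_trans; apply; rewrite -[s.+1%:R]natr1; lra.
Qed.

Section Word.
Variables (eC : rel 'I_N) (z0 : 'I_N * 'I_N).

Definition edge_list := [seq z <- enum {: 'I_N * 'I_N} | eC z.1 z.2].

(* The edges of the communication graph, listed twice: the first pass informs
   the direct neighbours of a player, the second one those at distance two. *)
Definition gossip_word := edge_list ++ edge_list.

Hypothesis two_hops : forall i j, e i j ->
  eC j i \/ exists c, [/\ eC j c, eC c i & e c j].

Lemma dis_word k (tau D : R) : 0 <= tau ->
  (forall r, (r < size gossip_word)%N -> sel (k + r)%N = nth z0 gossip_word r) ->
  (forall r, (r < size gossip_word)%N ->
    forall j, `|X (k + r).+1 j j - X (k + r)%N j j| <= tau) ->
  (forall i j, Ntil e i j -> dis k i j <= D) ->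
  forall i j, Ntil e i j -> dis (k + size gossip_word)%N i j <=
    (1 - 2^-1 ^+ size gossip_word) * D + (size gossip_word)%:R * tau.
Proof.
set B := size gossip_word => tau0 hsel hdr hD i j ij.
have D0 : 0 <= D by exact: le_trans (normr_ge0 _) (hD i j ij).
(* Bound for the players informed within s steps: the leader starts at 0, and
   averaging with an informed partner at most halves the remaining gap to D. *)
pose lev s : R := (1 - 2^-1 ^+ s) * D + s%:R * tau.
have h2 s : 0 <= (2^-1 : R) ^+ s <= 1.
  by rewrite exprn_ge0 ?invr_ge0// exprn_ile1// ?invr_ge0// invf_le1// ler1n.
have lev0 s : 0 <= lev s.
  have /andP[? ?] := h2 s.
  by rewrite /lev addr_ge0 ?mulr_ge0// subr_ge0.
have levB s : lev s <= D + s%:R * tau.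
  have /andP[? ?] := h2 s.
  by rewrite lerD2r ler_piMl// gerBl.
have levS s : (lev s + (D + s%:R * tau)) / 2 + tau = lev s.+1.
  by rewrite /lev exprS -natr1; field.
have all_le s : (s <= B)%N -> forall i j, Ntil e i j -> dis (k + s)%N i j <= D + s%:R * tau.
  by move=> sB; apply: dis_drift => // r rs; apply: hdr; apply: leq_trans sB.
have keep s i' : (s < B)%N -> Ntil e i' j -> dis (k + s)%N i' j <= lev s ->
    dis (k + s.+1)%N i' j <= lev s.+1.
  move=> sB ij' h; rewrite addnS -levS.
  apply: dis_keep => //; first exact: hdr.
    by rewrite lev0 levB.
  by move=> l lj; exact: all_le (ltnW sB) l j lj.
have mono s s' i' : (s <= s')%N -> (s' <= B)%N -> Ntil e i' j ->
    dis (k + s)%N i' j <= lev s -> dis (k + s')%N i' j <= lev s'.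
  move=> ss'; rewrite -(subnKC ss'); elim: (s' - s)%N => [|r IH]; first by rewrite addn0.
  rewrite addnS => rB ij' h; apply: keep => //; apply: IH => //; exact: ltnW.
have spread s a b : (s < B)%N -> nth z0 gossip_word s = (a, b) ->
    Ntil e a j -> Ntil e b j -> dis (k + s)%N a j <= lev s ->
    dis (k + s.+1)%N b j <= lev s.+1.
  move=> sB ws aj bj h; rewrite addnS -levS.
  have selE := hsel s sB; rewrite ws in selE.
  have := dis_spread (k + s)%N j tau (D + s%:R * tau) (lev s).
  rewrite selE /=; apply => //; [by apply/andP; split|exact: hdr| |].
    by rewrite lev0 levB.
  by move=> l lj; exact: all_le (ltnW sB) l j lj.
have self s : dis (k + s)%N j j <= lev s by rewrite dis_diag.
have jj : Ntil e j j by rewrite /Ntil eqxx.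
have BE : B = (size edge_list + size edge_list)%N by rewrite /B size_cat.
have idx a b : eC a b -> (index (a, b) edge_list < size edge_list)%N /\
    nth z0 edge_list (index (a, b) edge_list) = (a, b).
  move=> ab; have inE_ : (a, b) \in edge_list by rewrite mem_filter ab mem_enum.
  by rewrite index_mem nth_index.
have first_pass b : eC j b -> Ntil e b j -> exists s,
    [/\ (s < size edge_list)%N & dis (k + s.+1)%N b j <= lev s.+1].
  move=> jb bj; have [lt nt] := idx j b jb.
  exists (index (j, b) edge_list); split => //; apply: (spread _ j b) => //.
    by rewrite BE ltn_addr.
  by rewrite nth_cat lt.
move: (ij) => /orP[/eqP <-|eij]; first exact: self.
have [ji|[c [jc ci ecj]]] := two_hops i j eij.
  have [s [sE hs]] := first_pass i ji ij.
  by apply: mono hs => //; rewrite BE ltn_addr.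
have cj : Ntil e c j by rewrite /Ntil ecj orbT.
have [s [sE hs]] := first_pass c jc cj.
have [lt nt] := idx c i ci.
(* Position of (c, i) in the second pass, hence after the step of the first pass that informed c. *)
set r := (size edge_list + index (c, i) edge_list)%N.
have rB : (r < B)%N by rewrite BE /r ltn_add2l.
have hr : dis (k + r)%N c j <= lev r.
  by apply: mono hs => //; [exact: leq_trans (leq_addr _ _)|exact: ltnW].
apply: (mono r.+1) => //; apply: (spread r c i) => //.
by rewrite /gossip_word nth_cat /r ltnNge leq_addr /= addKn.
Qed.

Variables (C M q : R) (k0 : nat).
Hypotheses (C_gt0 : 0 < C) (q_gt0 : 0 < q).
Hypothesis drift : forall k, (k0 <= k)%N -> forall j,
  `|X k.+1 j j - X k j j| <= C / k.+1%:R.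
Hypothesis dis_bounded : forall k i j, Ntil e i j -> dis k i j <= M.
Let B := size gossip_word.
Hypothesis B_gt0 : (0 < B)%N.

Let is_word t := [forall r : 'I_B, sel (t * B + r)%N == nth z0 gossip_word r].

Hypothesis word_frequency :
  (fun n => (\sum_(t < n) (is_word t)%:R) / n%:R) @ \oo --> q.

(** A late time k comes shortly after an occurrence of the word at t0 = s B, relative to k. That
    occurrence contracts the bound by 1 - 2^-B, and the roughly k - t0 remaining steps cost at most
    C / t0 each, a total that is arbitrarily small. *)
Lemma consensus : forall eps : R, 0 < eps -> exists k1, forall k, (k1 <= k)%N ->
  forall i j, Ntil e i j -> `|X k i j - X k j j| <= eps.
Proof.
have h2 : 0 < (2^-1 : R) ^+ B <= 1.
  by rewrite exprn_gt0 ?invr_gt0// exprn_ile1// ?invr_ge0// invf_le1// ler1n.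
apply: (@eventually_contract R _ (1 - 2^-1 ^+ B) M).
- by move: h2 => /andP[? ?]; apply/andP; split; lra.
- move=> E E' EE' [k1 H]; exists k1 => k kk i j ij.
  by apply: le_trans EE'; exact: H.
- move=> E eta eta0 [k1 Hk1].
  (* delta <= 1/2 gives n <= 2 s. Since delta n >= 1, at most (n - s + 1) B <= 2 delta n B steps
     separate t0 from k, and their drift is below 2 delta n B C / (s B) <= 4 C delta <= eta. *)
  have [delta [d0 d1 d2]] : exists delta : R, [/\ 0 < delta, delta <= 2^-1 & 4 * C * delta <= eta].
    exists (Num.min 2^-1 (eta / (4 * C))); split.
    - by rewrite lt_min invr_gt0 ltr0n divr_gt0// mulr_gt0.
    - by rewrite ge_min lexx.
    - rewrite mulrC -ler_pdivlMr ?mulr_gt0//.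
      by rewrite ge_min lexx orbT.
  have [n0 Hn0] := recent_occurrence _ _ q_gt0 word_frequency _ d0.
  have [n1 Hn1] := (cvg_seqP _ _ _).1 (@cvg_harmonic R) _ d0.
  (* Requiring n > 2 K, together with n <= 2 s, puts s beyond K, so the drift bound and the old
     bound E already hold at t0 >= s. *)
  pose K := maxn k0 k1.
  exists ((maxn (maxn n0 n1.+1) (2 * K)).+1 * B)%N => k kbig i j ij.
  pose n := (k %/ B)%N.
  have nbig : (maxn (maxn n0 n1.+1) (2 * K) < n)%N by rewrite /n leq_divRL.
  have nk : (n * B <= k)%N by rewrite /n leq_divM.
  have kn : (k < n.+1 * B)%N by rewrite /n ltn_ceil.
  move: nbig; rewrite !gtn_max => /andP[/andP[n0n n1n] Kn].
  have [s [sn ws ns]] := Hn0 n (ltnW n0n).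
  have n_gt0 : (0 < n)%N := leq_ltn_trans (leq0n _) n0n.
  have nR : 0 < n%:R :> R by rewrite ltr0n.
  have harm : 1 <= delta * n%:R.
    have : (n1 <= n.-1)%N by rewrite -ltnS prednK// ltnW.
    move=> /Hn1; rewrite subr0 /harmonic /= prednK//.
    by rewrite ger0_norm// => h; rewrite -ler_pdivrMr// mul1r.
  have half : n%:R <= 2 * s%:R :> R.
    have : delta * n%:R <= 2^-1 * n%:R by rewrite ler_pM2r.
    by lra.
  have Ks : (K <= s)%N.
    move: half; rewrite -natrM ler_nat => half.
    by move: (ltnW (leq_trans Kn half)); rewrite leq_pmul2l.
  pose t0 := (s * B)%N.
  have st0 : (s <= t0)%N by rewrite /t0 leq_pmulr.
  pose tau := C / t0.+1%:R.
  have tau0 : 0 <= tau by rewrite divr_ge0// ltW.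
  have dr r j' : `|X (t0 + r).+1 j' j' - X (t0 + r)%N j' j'| <= tau.
    apply: le_trans (drift (t0 + r)%N _ j') _.
      move: Ks; rewrite geq_max => /andP[k0s _].
      by apply: leq_trans k0s (leq_trans st0 (leq_addr _ _)).
    by rewrite ler_pM2l// lef_pV2 ?posrE// ler_nat ltnS leq_addr.
  have tB : (t0 + B <= k)%N by apply: leq_trans nk; rewrite /t0 addnC -mulSn leq_mul2r sn orbT.
  have base i' j' : Ntil e i' j' -> dis t0 i' j' <= E.
    by apply: Hk1; move: Ks; rewrite geq_max => /andP[_ k1s]; exact: leq_trans st0.
  have atB := dis_word t0 tau E tau0 (fun r rB => eqP (forallP ws (Ordinal rB)))
    (fun r _ => dr r) base.
  have := dis_drift (t0 + B)%N (k - (t0 + B))%N tau _ _ atB i j ij.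
  rewrite subnKC// => /(_ (fun r _ j' => _)) H.
  have {}H : dis k i j <= (1 - 2^-1 ^+ B) * E + B%:R * tau + (k - (t0 + B))%:R * tau.
    by apply: H => r j'; rewrite -addnA; exact: dr.
  apply: le_trans H _; rewrite -addrA lerD2l -mulrDl -natrD.
  rewrite /tau mulrA ler_pdivrMr//.
  have cnt : (B + (k - (t0 + B)) <= (n - s).+1 * B)%N.
    rewrite subnDA addnC subnK; last by rewrite leq_subRL ?leq_addr// (leq_trans _ tB)// leq_addr.
    by rewrite leq_subLR /t0 -mulnDl addnS subnKC ?(ltnW sn)// ltnW.
  have B0 : 0 < B%:R :> R by rewrite ltr0n.
  have h1 : (B + (k - (t0 + B)))%:R * C <= (2 * delta * n%:R) * B%:R * C.
    rewrite ler_pM2r//; apply: (@le_trans _ _ (((n - s).+1 * B)%:R)); first by rewrite ler_nat.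
    rewrite natrM ler_pM2r// -natr1 natrB; last exact: ltnW.
    lra.
  apply: le_trans h1 _.
  have h3 : eta * (s%:R * B%:R) <= eta * t0.+1%:R.
    by rewrite ler_pM2l// -natrM ler_nat leqnSn.
  apply: le_trans h3.
  have h4 : 4 * C * delta * (s%:R * B%:R) <= eta * (s%:R * B%:R).
    by rewrite ler_wpM2r// mulr_ge0.
  apply: le_trans h4.
  have h5 : n%:R * (2 * delta * B%:R * C) <= 2 * s%:R * (2 * delta * B%:R * C).
    by rewrite ler_pM2r// !mulr_gt0.
  lra.
- by exists 0%N => k _ i j; exact: dis_bounded.
Qed.
End Word.
End Consensus.

(** * Pathwise convergence *)

Lemma finite_eventually (N : nat) (Q : 'I_N -> nat -> Prop) :
  (forall i, exists k0, forall k, (k0 <= k)%N -> Q i k) ->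
  exists k0, forall k, (k0 <= k)%N -> forall i, Q i k.
Proof.
move=> H; have [f Hf] := choice H.
exists (\max_i f i) => k fk i; apply: Hf.
by apply: leq_trans fk; exact: leq_bigmax.
Qed.

(* One player's step: [gh] is the gradient at the estimates, [F] the one at the
   true profile, [a] the player's own step size and [t] the common one. *)
Lemma energy_step (R : realFieldType)
    (d d' a gh F F' th th' t A K M G rho s w : R) :
  0 <= a <= A * t -> 0 <= t -> 0 <= A -> 0 <= G -> 0 <= M -> 0 <= s -> 0 <= w ->
  `|gh - F| <= K * rho -> `|d| <= M -> `|d'| <= M -> `|gh| <= G -> `|F| <= G ->
  `|F' - F| <= K * (G * (A * t)) -> `|d' - d| <= G * (A * t) ->
  d' ^+ 2 <= (d - a * gh) ^+ 2 ->
  `|a - (th' - th + t)| <= s * t -> `|th'| <= w ->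
  d' ^+ 2 + 2 * (th' * (F' * d')) <=
    d ^+ 2 + 2 * (th * (F * d)) - 2 * (F * d) * t +
    (2 * A * K * M * rho + A ^+ 2 * G ^+ 2 * t + 2 * s * G * M
      + 2 * (K * G * A * M + G ^+ 2 * A) * w) * t.
Proof.
move=> /andP[a0 aA] t0 A0 G0 M0 s0 w0 hg hd hd' hgh hF hFF hdd hd2 hath hth.
have prod3 (x y z X Y Z : R) : `|x| <= X -> `|y| <= Y -> `|z| <= Z ->
    `|x * y * z| <= X * Y * Z.
  by move=> hx hy hz; rewrite !normrM; apply: ler_pM => //; apply: ler_pM.
have a' : `|a| <= A * t by rewrite ger0_norm.
(* The four errors: [P1] replaces gh by F, [P2] is the quadratic term, [P3] exchanges the step a for
   th' - th + t, and [P4] accounts for the change of F d inside the correction. *)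
have /ler_normlP[P1 _] := prod3 _ _ _ _ _ _ a' hg hd.
have P2 : (a * gh) ^+ 2 <= (A * t * G) ^+ 2.
  rewrite -[X in X <= _]real_normK ?num_real// ler_sqr ?nnegrE ?mulr_ge0//.
  by rewrite normrM; apply: ler_pM.
have /ler_normlP[P3 _] := prod3 _ _ _ _ _ _ hath hF hd.
have P4 : th' * (F' * d' - F * d) <= w * (K * (G * (A * t)) * M + G * (G * (A * t))).
  apply: le_trans (ler_norm _) _; rewrite normrM; apply: ler_pM => //.
  have -> : F' * d' - F * d = (F' - F) * d' + F * (d' - d) by ring.
  apply: le_trans (ler_normD _ _) _; rewrite !normrM.
  by apply: lerD; apply: ler_pM.
by lra.
Qed.

Section Pathwise.
Context {R : realType} {N : nat} {e : rel 'I_N} {Omega : 'I_N -> set R}.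
Context {J g : 'I_N -> R -> ('I_N -> R) -> R} {sigma L : 'I_N -> R}.
Hypothesis ga : game_assumptions e Omega J g sigma L.
Variables (sel : nat -> 'I_N * 'I_N) (x0 : 'cV[R]_(mdim e)) (xs : 'I_N -> R).
Hypothesis x0_in : forall i j, Ntil e i j -> Omega j (entry x0 i j).
Hypothesis nash : nash_equilibrium Omega J xs.

Let X k i j := entry (state Omega g sel x0 k) i j.
Let Xhat k i := entry (Wmat R e (sel k).1 (sel k).2 *m state Omega g sel x0 k) i.

Let hO := let: And5 h _ _ _ _ := ga in h.

Lemma Ntil_refl (i : 'I_N) : Ntil e i i.
Proof. by rewrite /Ntil eqxx. Qed.

Lemma gossip_avg_in_Omega (x : 'I_N -> 'I_N -> R) a b i j :
  (forall i j, Ntil e i j -> Omega j (x i j)) -> Ntil e i j ->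
  Omega j (gossip_avg e x a b i j).
Proof.
move=> hx ij; have [/andP[indj iab]|out] := boolP (ind e a b j && ((i == a) || (i == b))).
  rewrite gossip_avg_in//; have /andP[aj bj] := indj.
  have -> : (x a j + x b j) / 2 = 2^-1 * x a j + (1 - 2^-1) * x b j by field.
  have [_ [_ cv]] := hO j; apply: cv; [exact: hx|exact: hx|].
  by rewrite invr_ge0 ler0n invf_le1// ler1n.
by rewrite gossip_avg_out//; exact: hx.
Qed.

Lemma gossip_avg_close (x : 'I_N -> 'I_N -> R) a b i j c rho :
  (forall i, Ntil e i j -> `|x i j - c| <= rho) -> Ntil e i j ->
  `|gossip_avg e x a b i j - c| <= rho.
Proof.
move=> hx ij; have [/andP[indj iab]|out] := boolP (ind e a b j && ((i == a) || (i == b))).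
  rewrite gossip_avg_in//; have /andP[/hx aj /hx bj] := indj.
  have -> : (x a j + x b j) / 2 - c = ((x a j - c) + (x b j - c)) / 2 by field.
  rewrite normrM [X in _ * X]ger0_norm ?invr_ge0// ler_pdivrMr//.
  by apply: le_trans (ler_normD _ _) _; lra.
by rewrite gossip_avg_out ?hx.
Qed.

Lemma state_in_Omega k i j : Ntil e i j -> Omega j (X k i j).
Proof.
elim: k i j => [|k IH] i j ij; first exact: x0_in.
rewrite /X /= entry_step//; case: eqP => [<-|_]; last exact: gossip_avg_in_Omega.
case: ifP => _; last exact: IH (Ntil_refl i).
by have [neO [cO _]] := hO i; exact: (projP _ neO cO _).1.
Qed.

Let x_in k : in_Omega Omega (fun j => X k j j).
Proof. by move=> j; exact: state_in_Omega (Ntil_refl j). Qed.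

Let XhatE k i j : e i j ->
  Xhat k i j = gossip_avg e (X k) (sel k).1 (sel k).2 i j.
Proof. by move=> ij; rewrite /Xhat entry_Wmat// /Ntil ij orbT. Qed.

Let Xhat_in k i : in_Omega_minus e Omega i (Xhat k i).
Proof.
move=> j ij; rewrite XhatE//; apply: gossip_avg_in_Omega; last by rewrite /Ntil ij orbT.
exact: state_in_Omega.
Qed.

Let chosen i t := (i == (sel t).1) || (i == (sel t).2).
Let count i n : nat := \sum_(t < n) (chosen i t : nat).
(** The step size actually applied, 0 for an idle player. The update at time k counts itself in
    [nupdates], hence [count i k.+1]. *)
Let gain k i : R := (chosen i k)%:R / (count i k.+1)%:R.

Let gain_ge0 k i : 0 <= gain k i.
Proof. by rewrite /gain divr_ge0. Qed.

Let update_sqr_le k i :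
  (X k.+1 i i - xs i) ^+ 2 <=
  (X k i i - xs i - gain k i * g i (X k i i) (Xhat k i)) ^+ 2.
Proof.
rewrite [X k.+1 i i]/X /= (entry_step _ _ _ _ _ _ _ _ (Ntil_refl i)) eqxx /gain /chosen.
case: ifP => _; last by rewrite mul0r mul0r subr0.
have [neO [cO vO]] := hO i.
apply: le_trans (proj_sqr_le _ neO cO vO _ _ (nash.1 i)) _.
by rewrite mul1r addrAC.
Qed.

Let update_norm_le k i G : `|g i (X k i i) (Xhat k i)| <= G ->
  `|X k.+1 i i - X k i i| <= gain k i * G.
Proof.
move=> hG.
rewrite [X k.+1 i i]/X /= (entry_step _ _ _ _ _ _ _ _ (Ntil_refl i)) eqxx /gain /chosen.
case: ifP => _; last by rewrite subrr normr0 !mul0r.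
have [neO [cO vO]] := hO i.
apply: le_trans (proj_norm_le _ neO cO vO _ _ (x_in k i)) _.
rewrite mul1r addrAC subrr add0r normrN normrM ger0_norm ?invr_ge0//.
by rewrite ler_wpM2l ?invr_ge0.
Qed.

Variable p : 'I_N -> R.
Hypothesis p_gt0 : forall i, 0 < p i.
Hypothesis player_frequency : forall i,
  (fun n => (\sum_(t < n) ((i == (sel t).1) || (i == (sel t).2))%:R) / n%:R)
    @ \oo --> p i.

Let countR i n :
  (count i n)%:R = \sum_(t < n) ((i == (sel t).1) || (i == (sel t).2))%:R :> R.
Proof. by rewrite /count natr_sum. Qed.

Let count_linear : exists2 A : R, 0 < A &
  exists k0, forall k, (k0 <= k)%N -> forall i, k%:R <= A * (count i k)%:R.
Proof.
(* One constant dominating every 2 / p i, since eventually the count is at least p i k / 2. *)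
exists (1 + \sum_i 2 / p i).
  by rewrite ltr_pwDl// sumr_ge0// => i _; rewrite divr_ge0// ltW.
apply: finite_eventually => i.
have p2 : 0 < p i / 2 by rewrite divr_gt0.
have [k0 Hk0] := (cvg_seqP _ _ _).1 (player_frequency i) _ p2.
exists k0.+1 => k kk; have k_gt0 : 0 < k%:R :> R by rewrite ltr0n; apply: leq_trans kk.
move: (Hk0 k (ltnW kk)); rewrite -countR ler_norml => /andP[low _].
have : p i / 2 <= (count i k)%:R / k%:R by lra.
rewrite ler_pdivlMr// => h.
have h1 : 2 / p i <= 1 + \sum_i 2 / p i.
  rewrite ler_wpDl// (bigD1 i)//= lerDl sumr_ge0// => j _.
  by rewrite divr_ge0// ltW.
apply: (@le_trans _ _ (2 / p i * (count i k)%:R)); last by rewrite ler_wpM2r.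
apply: (@le_trans _ _ (2 / p i * (p i / 2 * k%:R))).
  by rewrite mulrA (_ : 2 / p i * (p i / 2) = 1) ?mul1r//; field; rewrite gt_eqF.
by rewrite ler_pM2l// divr_gt0.
Qed.

Let theta k i : R := ln ((count i k)%:R / k%:R) - ln (p i).

Let theta_cvg0 i : forall eps : R, 0 < eps ->
  exists k0, forall k, (k0 <= k)%N -> `|theta k i| <= eps.
Proof.
move=> eps eps0.
have cv : (fun k => ln ((count i k)%:R / k%:R)) @ \oo --> ln (p i).
  apply: (@cvg_comp _ _ _ (fun k => (count i k)%:R / k%:R) (@ln R) _ (nbhs (p i))).
    under eq_fun do rewrite countR; exact: player_frequency.
  exact: continuous_ln.
exact: (cvg_seqP _ _ _).1 cv eps eps0.
Qed.

(** The increment of [theta] is that of ln count minus that of ln k. By [ln_succ_bounds] the former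
    is [gain] up to A^2 / (k (k+1)), with both equal to 0 for an idle player, and the latter is
    1/(k+1) up to 1 / (k (k+1)). *)
Let theta_step (A : R) k i : 0 < A -> (0 < k)%N ->
  k%:R <= A * (count i k)%:R -> k.+1%:R <= A * (count i k.+1)%:R ->
  `|gain k i - (theta k.+1 i - theta k i + k.+1%:R^-1)|
    <= (A ^+ 2 + 1) / k%:R * k.+1%:R^-1.
Proof.
move=> A0 k0 hk hk1.
have kR : 0 < k%:R :> R by rewrite ltr0n.
have k1R : 0 < k.+1%:R :> R by [].
have cR : 0 < (count i k)%:R :> R.
  by rewrite -(pmulr_rgt0 _ A0); apply: lt_le_trans hk.
have c1R : 0 < (count i k.+1)%:R :> R.
  by rewrite -(pmulr_rgt0 _ A0); apply: lt_le_trans hk1.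
have := @ln_succ_bounds R k k0.
rewrite /theta !ln_div ?posrE//.
have bnd : 0 <= ln (count i k.+1)%:R - ln (count i k)%:R - gain k i <=
    A ^+ 2 / (k%:R * k.+1%:R).
  have cS : count i k.+1 = (count i k + chosen i k)%N by rewrite /count big_ord_recr.
  have h0 : 0 <= A ^+ 2 / (k%:R * k.+1%:R) by rewrite divr_ge0 ?sqr_ge0// mulr_ge0.
  have [ch|ch] := boolP (chosen i k); last first.
    by rewrite /gain cS (negPf ch) addn0 !mul0r subrr subr0 lexx.
  have cS1 : count i k.+1 = (count i k).+1 by rewrite cS ch addn1.
  rewrite /gain ch mul1r.
  have c0 : (0 < count i k)%N by rewrite -(ltr0n R).
  have /andP[l u] := @ln_succ_bounds R (count i k) c0.
  rewrite cS1 l /=; apply: le_trans u _.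
  rewrite -cS1 ler_pdivlMr ?mulr_gt0// mulrC ler_pdivrMr ?mulr_gt0//.
  have -> : A ^+ 2 * ((count i k)%:R * (count i k.+1)%:R) =
    (A * (count i k)%:R) * (A * (count i k.+1)%:R) by ring.
  exact: ler_pM (ltW kR) (ltW k1R) hk hk1.
have -> : (A ^+ 2 + 1) / k%:R * k.+1%:R^-1 = A ^+ 2 / (k%:R * k.+1%:R) + (k%:R * k.+1%:R)^-1.
  by field; rewrite !gt_eqF.
move: bnd => /andP[b1 b2] /andP[b3 b4].
have i0 : 0 <= (k%:R * k.+1%:R)^-1 :> R by rewrite invr_ge0 mulr_ge0.
move: b1 b2 b3 b4 i0.
move: (ln (k%:R : R)) (ln (k.+1%:R : R)) (ln (count i k)%:R) (ln (count i k.+1)%:R)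
  (ln (p i)) (gain k i) (k.+1%:R^-1 : R) (A ^+ 2 / (k%:R * k.+1%:R))
  ((k%:R * k.+1%:R)^-1 : R) => *.
by rewrite ler_norml; apply/andP; split; lra.
Qed.

Variables (eC : rel 'I_N) (z0 : 'I_N * 'I_N) (q : R).
Let B := size (gossip_word eC).
Hypothesis two_hops : forall i j, e i j ->
  eC j i \/ exists c, [/\ eC j c, eC c i & e c j].
Hypotheses (q_gt0 : 0 < q) (B_gt0 : (0 < B)%N).
Hypothesis word_frequency :
  (fun n => (\sum_(t < n) [forall r : 'I_B, sel (t * B + r)%N ==
     nth z0 (gossip_word eC) r]%:R) / n%:R) @ \oo --> q.

Let inv_small (r : R) : 0 < r -> exists k0, forall k, (k0 <= k)%N ->
  (0 < k)%N /\ k%:R^-1 <= r.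
Proof.
move=> r0; have [k1 Hk1] := (cvg_seqP _ _ _).1 (@cvg_harmonic R) _ r0.
exists k1.+1 => -[//|k] kk; split => //.
by move: (Hk1 k kk); rewrite subr0 /harmonic /= ger0_norm.
Qed.

(** Dividing by c + 1 instead of c allows c = 0. *)
Let mul_small (c r eta : R) : 0 <= c -> 0 < eta -> r <= eta / (c + 1) -> c * r <= eta.
Proof.
move=> c0 eta0; rewrite ler_pdivlMr; last by lra.
move=> h; have [r0|r0] := leP 0 r; first by lra.
by apply: le_trans (ltW eta0); rewrite mulr_ge0_le0// ltW.
Qed.

Lemma sqr_dist_vanishes : forall eps : R, 0 < eps -> exists k1, forall k, (k1 <= k)%N ->
  \sum_i (X k i i - xs i) ^+ 2 <= eps.
Proof.
have [M M0 HM] := actions_bounded _ _ _ _ _ _ ga.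
have [K K0 HK] := gradient_lipschitz _ _ _ _ _ _ ga.
have [G G0 HG] := gradient_bounded _ _ _ _ _ _ ga xs nash.1.
have [A A0 [k0 Hk0]] := count_linear.
pose F k i := g i (X k i i) (fun j => X k j j).
pose dd k i := X k i i - xs i.
have t_gt0 k : 0 < k.+1%:R^-1 :> R by rewrite invr_gt0.
have gain_le k i : (k0 <= k)%N -> gain k i <= A * k.+1%:R^-1.
  move=> kk; have h := Hk0 k.+1 (leqW kk) i.
  have c1R : 0 < (count i k.+1)%:R :> R.
    by rewrite -(pmulr_rgt0 _ A0); apply: lt_le_trans h.
  rewrite /gain ler_pdivrMr// mulrAC ler_pdivlMr//.
  by apply: le_trans h; case: chosen; rewrite ?mul1r ?mul0r.
have hg k i : `|g i (X k i i) (Xhat k i)| <= G.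
  by apply: HG; [exact: x_in|exact: Xhat_in].
have hF k i : `|F k i| <= G by apply: HG; [exact: x_in|move=> j _; exact: x_in].
have hd k i : `|dd k i| <= M by apply: (HM i); [exact: x_in|exact: nash.1].
have hmove k i : (k0 <= k)%N -> `|X k.+1 i i - X k i i| <= G * (A * k.+1%:R^-1).
  move=> kk; apply: le_trans (update_norm_le k i G (hg k i)) _.
  by rewrite mulrC ler_pM2l// gain_le.
have cons := consensus e X sel _ eC z0 two_hops (G * A) M q k0
  _ q_gt0 _ _ B_gt0 word_frequency.
have {}cons (eps : R) : 0 < eps -> exists k1, forall k, (k1 <= k)%N ->
    forall i j, Ntil e i j -> `|X k i j - X k j j| <= eps.
  apply: cons.
  - by move=> k i j ij nij; rewrite [X k.+1 i j]/X /= entry_step// (negPf nij).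
  - exact: mulr_gt0.
  - by move=> k kk j; rewrite -mulrA; exact: hmove.
  - by move=> k i j ij; apply: (HM j); [exact: state_in_Omega|exact: x_in].
pose u k i := dd k i ^+ 2 + 2 * (theta k i * (F k i * dd k i)).
(* [U] is the corrected energy, [V] the squared distance to x*, and [Phi] the pairing of the
   pseudo-gradient with x - x*. *)
apply: (@harmonic_descent R (fun k => \sum_i u k i) _ (fun k => \sum_i F k i * dd k i)).
- move=> eps0 eps00.
  (* The share of one player; each of the four error terms of [energy_step] receives a quarter of
     it. *)
  pose eps := eps0 / N.+1%:R.
  have eps_gt0 : 0 < eps by rewrite divr_gt0.
  have eta0 : 0 < eps / 4 by rewrite divr_gt0.
  have [c1 [c2 [c3 c4]]] : [/\ 0 <= 2 * A * K * M, 0 <= A ^+ 2 * G ^+ 2,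
     0 <= 2 * (A ^+ 2 + 1) * G * M & 0 <= 2 * (K * G * A * M + G ^+ 2 * A)].
    have A0' := ltW A0; have G0' := ltW G0; have K0' := ltW K0.
    by split; rewrite ?mulr_ge0 ?addr_ge0 ?mulr_ge0 ?sqr_ge0.
  have pos c : 0 <= c -> 0 < eps / 4 / (c + 1) by move=> ?; rewrite divr_gt0// ltr_wpDl.
  have [k1 Hk1] := cons _ (pos _ c1).
  have [k2 Hk2] := inv_small _ (pos _ c2).
  have [k3 Hk3] := inv_small _ (pos _ c3).
  have [k4 Hk4] := finite_eventually N (fun i k => `|theta k i| <= _)
    (fun i => theta_cvg0 i _ (pos _ c4)).
  exists (maxn (maxn k0 k1) (maxn (maxn k2 k3) k4)) => k.
  rewrite !geq_max => /andP[/andP[kk0 kk1] /andP[/andP[kk2 kk3] kk4]].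
  have [k_gt0 small3] := Hk3 k kk3.
  have [_ small2] := Hk2 k.+1 (leqW kk2).
  have step i : u k.+1 i <= u k i - 2 * (F k i * dd k i) / k.+1%:R + eps / k.+1%:R.
    have a01 : 0 <= gain k i <= A * k.+1%:R^-1 by rewrite gain_ge0 gain_le.
    have s0 : 0 <= (A ^+ 2 + 1) / k%:R :> R.
      by rewrite divr_ge0// addr_ge0// sqr_ge0.
    have hgF : `|g i (X k i i) (Xhat k i) - F k i| <=
        K * (eps / 4 / (2 * A * K * M + 1)).
      apply: HK; [exact: x_in|exact: x_in|exact: Xhat_in|by move=> j _; exact: x_in| |].
        by rewrite subrr normr0 ltW// pos.
      move=> j ij; rewrite XhatE//; apply: gossip_avg_close; last by rewrite /Ntil ij orbT.
      by move=> l lj; exact: Hk1.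
    have hFF : `|F k.+1 i - F k i| <= K * (G * (A * k.+1%:R^-1)).
      apply: HK; [exact: x_in|exact: x_in|by move=> j _; exact: x_in|by move=> j _; exact: x_in| |].
        exact: hmove.
      by move=> j _; exact: hmove.
    have hdd : `|dd k.+1 i - dd k i| <= G * (A * k.+1%:R^-1).
      have -> : dd k.+1 i - dd k i = X k.+1 i i - X k i i by rewrite /dd; ring.
      exact: hmove.
    have := energy_step R (dd k i) (dd k.+1 i) (gain k i) _ (F k i) (F k.+1 i)
      (theta k i) (theta k.+1 i) k.+1%:R^-1 A K M G _ ((A ^+ 2 + 1) / k%:R) _
      a01 (ltW (t_gt0 k)) (ltW A0) (ltW G0) M0 s0 (ltW (pos _ c4)) hgF (hd k i) (hd k.+1 i)
      (hg k i) (hF k i) hFF hdd (update_sqr_le k i)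
      (theta_step A k i A0 k_gt0 (Hk0 k kk0 i) (Hk0 k.+1 (leqW kk0) i))
      (Hk4 k.+1 (leqW kk4) i).
    move/le_trans; apply; rewrite /u lerD2l ler_pM2r//.
    have T1 := mul_small _ _ _ c1 eta0 (lexx _).
    have T2 := mul_small _ _ _ c2 eta0 small2.
    have T3 := mul_small _ _ _ c3 eta0 small3.
    have T4 := mul_small _ _ _ c4 eta0 (lexx _).
    have -> : 2 * ((A ^+ 2 + 1) / k%:R) * G * M = 2 * (A ^+ 2 + 1) * G * M * k%:R^-1 by ring.
    apply: le_trans (lerD (lerD (lerD T1 T2) T3) T4) _.
    by have -> : eps / 4 + eps / 4 + eps / 4 + eps / 4 = eps by field.
  apply: (@le_trans _ _ (\sum_i (u k i - 2 * (F k i * dd k i) / k.+1%:R + eps / k.+1%:R))).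
    by apply: ler_sum => i _; exact: step.
  rewrite big_split sumrB /= lerD//.
    by rewrite lerD2l lerN2 mulr_sumr mulr_suml.
  rewrite sumr_const card_ord -[X in X <= _]mulr_natl mulrA ler_pM2r//.
  by rewrite /eps mulrCA ler_piMr ?(ltW eps00)// ler_pdivrMr// mul1r ler_nat.
- move=> eps eps0.
  (* The correction is at most 2 G M N times a common bound on the [theta k i], which tend to 0. *)
  have c0 : 0 <= 2 * G * M * N%:R by rewrite !mulr_ge0// ltW.
  have w0 : 0 < eps / (2 * G * M * N%:R + 1) by rewrite divr_gt0// ltr_wpDl.
  have [k1 Hk1] := finite_eventually N (fun i k => `|theta k i| <= _)
    (fun i => theta_cvg0 i _ w0).
  exists k1 => k kk; rewrite -sumrB.
  apply: le_trans (ler_norm_sum _ _ _) _.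
  apply: le_trans (mul_small _ _ _ c0 eps0 (lexx _)).
  move: (eps / _) Hk1 w0 => w Hk1 w0.
  have -> : 2 * G * M * N%:R * w = \sum_(i < N) 2 * G * M * w.
    by rewrite sumr_const card_ord -[RHS]mulr_natl; ring.
  apply: ler_sum => i _.
  have -> : u k i - (X k i i - xs i) ^+ 2 = 2 * (theta k i * (F k i * dd k i)).
    by rewrite /u addrAC subrr add0r.
  rewrite normrM ger0_norm// -!mulrA ler_pM2l//.
  have -> : G * (M * w) = w * (G * M) by ring.
  rewrite !normrM; apply: ler_pM => //; first exact: Hk1.
  by apply: ler_pM.
- move=> eps eps0.
  have [c c0 Hc] := pairing_coercive _ _ _ _ _ _ ga xs nash eps eps0.
  by exists c => // k; exact: (Hc (fun j => X k j j) (x_in k)).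
- by move=> k; exact: (pairing_ge0 _ _ _ _ _ _ ga xs nash (fun j => X k j j) (x_in k)).
Qed.
End Pathwise.

(** * Convergence almost surely *)

(** If the edge ij is missing from em, adding it closes a triangle whose two other edges lie in em
    and meet at a vertex c. As em is contained in e, c is a neighbour of j in e, so it carries an
    estimate of j and can relay it. *)
Lemma maximal_triangle_free_two_hops (N : nat) (e eC em : rel 'I_N) :
  simple_graph e -> simple_graph eC ->
  maximal_triangle_free_spanning em e -> subrel em eC ->
  forall i j, e i j -> eC j i \/ exists c, [/\ eC j c, eC c i & e c j].
Proof.
move=> [esym eirr] [Csym _] [[msym mirr] me tf maxm] mC i j eij.
have [mij|nmij] := boolP (em i j); first by left; rewrite Csym mC.
right; suff [c [ic cj]] : exists c, em i c /\ em c j.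
  exists c; split; last exact: me.
    by rewrite Csym mC.
  by rewrite Csym mC.
have nij : i <> j by move=> ij; move: eij; rewrite ij eirr.
have addP x y : add_edge em i j x y ->
    [\/ em x y, x = i /\ y = j | x = j /\ y = i].
  by move=> /or3P[?|/andP[/eqP ? /eqP ?]|/andP[/eqP ? /eqP ?]];
    [constructor 1|constructor 2|constructor 3].
have loop x : em x x -> False by rewrite mirr.
apply: contrapT => none; apply: (maxm i j eij nmij) => -[a [b [c]]].
move=> /and3P[/addP ab /addP bc /addP ca].
have cherry x y z : em x y -> em y z -> (z = i /\ x = j) \/ (z = j /\ x = i) -> False.
  move=> xy yz [[zi xj]|[zj xi]]; apply: none; exists y.
    by rewrite -zi -xj msym yz msym.
  by rewrite -xi -zj.
(* Each side is old or is the new edge in one orientation. Three old sides contradict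
   triangle-freeness, a single new one gives the path i, c, j, and several new ones force a loop of
   em or i = j. *)
case: ab => [ab|[ai bj]|[aj bi]]; case: bc => [bc|[b' c']|[b' c']];
  case: ca => [ca|[c'' a']|[c'' a']]; subst => //;
  try (by [exact: (loop _ ab)|exact: (loop _ bc)|exact: (loop _ ca)]).
- by apply: tf; exists a, b, c; rewrite ab bc ca.
all: by [apply: (cherry _ _ _ ab bc); auto|apply: (cherry _ _ _ bc ca); auto|
  apply: (cherry _ _ _ ca ab); auto|exfalso; apply: nij].
Qed.

Lemma connected_neighbour (N : nat) (e : rel 'I_N) (i : 'I_N) :
  (2 <= N)%N -> connected_graph e -> exists j, e i j.
Proof.
move=> N2 conn; have [j ij] : exists j : 'I_N, i != j.
  have : (0 < #|predC1 i|)%N by rewrite cardC1 card_ord; case: (N) N2 => // -[].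
  by move=> /card_gt0P[j]; rewrite inE eq_sym; exists j.
have /connectP[[|k s] /= pth jE] := conn i j; first by rewrite jE eqxx in ij.
by exists k; case/andP: pth.
Qed.

Lemma row_cvg (R : realType) (N : nat) (u : nat -> 'rV[R]_N) (x : 'I_N -> R) :
  (forall eps : R, 0 < eps -> exists k1, forall k, (k1 <= k)%N ->
    \sum_i (u k 0 i - x i) ^+ 2 <= eps) ->
  u @ \oo --> \row_i x i.
Proof.
move=> H; apply/cvg_ballP => eps eps0.
have e20 : 0 < (eps / 2) ^+ 2 by rewrite exprn_gt0// divr_gt0.
have [k1 Hk1] := H _ e20; exists k1 => // k /= kk; split => // a j.
rewrite -ball_normE /ball_ /= ord1 mxE distrC.
apply: (@le_lt_trans _ _ (eps / 2)); last by lra.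
rewrite -ler_sqr ?nnegrE// ?divr_ge0 ?(ltW eps0)// real_normK ?num_real//.
apply: le_trans (Hk1 k kk); rewrite (bigD1 j)//= lerDl.
by apply: sumr_ge0 => l _; exact: sqr_ge0.
Qed.

Theorem theorem2 (R : realType) (N : nat) (e eC : rel 'I_N)
  (Omega : 'I_N -> set R) (J g : 'I_N -> R -> ('I_N -> R) -> R)
  (sigma L : 'I_N -> R)
  (d : measure_display) (T : measurableType d) (P : probability T R)
  (I Js : nat -> T -> 'I_N) (x0 : 'cV[R]_(mdim e)) (xs : 'I_N -> R) :
  (2 <= N)%N ->
  simple_graph e -> connected_graph e -> ~ complete_graph e ->
  simple_graph eC -> subrel eC e ->
  (exists em, maximal_triangle_free_spanning em e /\ subrel em eC) ->
  game_assumptions e Omega J g sigma L ->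
  iid_selection eC P I Js ->
  (forall i j, Ntil e i j -> Omega j (entry x0 i j)) ->
  nash_equilibrium Omega J xs ->
  {ae P, forall w,
     actions Omega g (fun k => (I k w, Js k w)) x0 @ \oo --> \row_i xs i}.
Proof.
move=> N2 es ec _ Cs _ [em [mtf mC]] ga iid x0_in nash.
have two_hops := maximal_triangle_free_two_hops N e eC em es Cs mtf mC.
have Cnb i : exists c, eC i c.
  have [k eik] := connected_neighbour N e i N2 ec.
  case: (two_hops i k eik) => [ki|[c [_ ci _]]]; [exists k|exists c]; by rewrite Cs.1.
have i0 : 'I_N := Ordinal (ltnW N2).
(* [z0] is a genuine edge: besides being the default of [nth], it shows that the word is
   nonempty. *)
have [c0 ic0] := Cnb i0; pose z0 := (i0, c0).
pose word := gossip_word eC; pose B := size word.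
have z0E : z0 \in edge_list eC by rewrite mem_filter mem_enum andbT.
have B_gt0 : (0 < B)%N.
  by rewrite /B size_cat ltn_addr//; case: (edge_list eC) z0E.
have wordC r : (r < B)%N -> eC (nth z0 word r).1 (nth z0 word r).2.
  move=> rB; have : nth z0 word r \in word by exact: mem_nth.
  by rewrite mem_cat orbb mem_filter => /andP[].
pose player i : pred ('I_N * 'I_N) := fun z => (i == z.1) || (i == z.2).
pose p i := @mass R N eC (player i).
have p_gt0 i : 0 < p i.
  have [c ic] := Cnb i.
  by apply: (@mass_gt0 R N eC (player i) (i, c)) => //; rewrite /player eqxx.
pose q := \prod_(r < B) @mass R N eC (pred1 (nth z0 word r)).
have q_gt0 : 0 < q.
  apply: prodr_gt0 => r _.
  by apply: (@mass_gt0 R N eC _ (nth z0 word r)); [exact: eqxx|exact: wordC].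
have indicb (A : set T) (b : bool) w : (A w <-> b) -> \1_A w = b%:R :> R.
  by move=> Ab; rewrite indicE; congr (_%:R); congr nat_of_bool; apply/idP/idP; rewrite inE => /Ab.
have eq_cvgn (u v : nat -> R) l : u =1 v -> u @ \oo --> l -> v @ \oo --> l.
  by move=> /funext ->.
have players : \forall w \near almost_everywhere P, forall i,
    (fun n => (\sum_(t < n) ((i == I t w) || (i == Js t w))%:R) / n%:R)
      @ \oo --> p i.
  apply: filter_forall => i.
  (* With blocks of length one, the block events are the selections of player i at each time. *)
  have := block_frequency eC P I Js iid i0 1 (fun=> player i).
  rewrite big_ord_recr big_ord0 /= mul1r; apply: filterS => w.
  apply: eq_cvgn => n; congr (_ / _).
  apply: eq_bigr => t _; apply: indicb.
  rewrite /block_event /player /=; split => [/(_ 0%N isT)|H [|//] _].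
    by rewrite muln1 addn0.
  by rewrite muln1 addn0.
have words := block_frequency eC P I Js iid i0 B (fun r => pred1 (nth z0 word r)).
apply: filterS2 players words => w playersw wordsw.
apply: row_cvg => eps eps0.
have wf : (fun n => (\sum_(t < n) [forall r : 'I_B,
      (I (t * B + r)%N w, Js (t * B + r)%N w) == nth z0 word r]%:R) / n%:R) @ \oo --> q.
  apply: eq_cvgn wordsw => n; congr (_ / _).
  apply: eq_bigr => t _; apply: indicb; split.
    by move=> H; apply/forallP => r; exact: H.
  by move=> /forallP H r rB; exact: (H (Ordinal rB)).
have [k1 Hk1] := sqr_dist_vanishes ga (fun k => (I k w, Js k w)) x0 xs x0_in nash
  p p_gt0 playersw eC z0 q two_hops q_gt0 B_gt0 wf eps eps0.
exists k1 => k kk; apply: le_trans (Hk1 k kk).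
by apply: ler_sum => i _; rewrite mxE.
Qed.
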